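(* For each prime $p$ with $p\ne 2,3,7,17,23$, there exist integers $a,b,c,d$ satisfying $a\equiv d\pmod 5$, $b\equiv c\pmod 5$, and \[ p=\frac{1}{5}\left(a^2+29b^2+c^2+29d^2\right). \] *)

(* Defs.v *)
From Stdlib Require Import ZArith Znumtheory.

(* Main.v *)
(** The form is [H(u, w) = 5 |u|^2 + 2 Re(u conj(w)) + 6 |w|^2] on Gaussian integers. Having determinant
    29, it embeds in [|z1|^2 + |z2|^2] as a sublattice of index 29, cut out by one linear congruence
    modulo 29. Hence [p] is represented as soon as some integer vector [v] of norm [p] satisfies this
    congruence up to a signed permutation of its coordinates, possibly after a reflection in a
    vector of norm 3 that maps [v] to an integer vector. By a finite computation modulo 29 and 3,
    every [v] for which the sum of the first two coordinates lies in a suitable residue class modulo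
    29 (depending on [p]) has this property. Prescribing this sum [w] amounts to writing the number
    [2 p - w^2], which is 1 modulo 4, as a sum of three squares.

    The three-square theorem is proved without Dirichlet's theorem. For [n] congruent to 1 modulo 4
    let [chi] be the real character modulo [N = 4 n] with [chi(q) = (-n/q)], and let [g(m)] be the sum
    of [chi] over the divisors of [m]. If [chi(eps) = 1], the hyperbola method shows that the sums of
    [g(m) / sqrt m] over [m <= Y^2] in the classes of [eps] and of 1 modulo [N] differ by a bounded
    amount; the latter is unbounded because [g >= 0] and [g(k^2) >= 1]. So [g(m) > 0] for some [m] in
    the class of [eps], and up to a square factor [m] is a number [d] modulo which [-n] is a square.
    For a suitable [eps], [-d] is a square modulo [n], which yields a positive ternary form of
    determinant 1 representing [n]; such a form is a sum of three squares. *)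

Require Import Defs.
From Stdlib Require Import ZArith Znumtheory Lia List Bool.
Import ListNotations.
Open Scope Z_scope.

(** * Unimodular ternary forms *)

(** The ternary form with diagonal coefficients [a], [b], [c] and half cross terms [f], [g], [h]
    (for the pairs 23, 13, 12 of variables) is a sum of three squares of integral linear forms. *)
Definition is_gram (a b c f g h : Z) : Prop :=
  exists x1 x2 x3 y1 y2 y3 z1 z2 z3 : Z,
    a = x1 ^ 2 + x2 ^ 2 + x3 ^ 2 /\ b = y1 ^ 2 + y2 ^ 2 + y3 ^ 2 /\
    c = z1 ^ 2 + z2 ^ 2 + z3 ^ 2 /\ f = y1 * z1 + y2 * z2 + y3 * z3 /\
    g = x1 * z1 + x2 * z2 + x3 * z3 /\ h = x1 * y1 + x2 * y2 + x3 * y3.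

Lemma is_gram_swap12 a b c f g h : is_gram b a c g f h -> is_gram a b c f g h.
Proof.
intros (x1 & x2 & x3 & y1 & y2 & y3 & z1 & z2 & z3 & -> & -> & -> & -> & -> & ->).
exists y1, y2, y3, x1, x2, x3, z1, z2, z3; repeat split; ring.
Qed.

Lemma is_gram_swap23 a b c f g h : is_gram a c b f h g -> is_gram a b c f g h.
Proof.
intros (x1 & x2 & x3 & y1 & y2 & y3 & z1 & z2 & z3 & -> & -> & -> & -> & -> & ->).
exists x1, x2, x3, z1, z2, z3, y1, y2, y3; repeat split; ring.
Qed.

Lemma is_gram_add12 k a b c f g h :
  is_gram a (b + 2 * k * h + k ^ 2 * a) c (f + k * g) g (h + k * a) ->
  is_gram a b c f g h.
Proof.
intros (x1 & x2 & x3 & y1 & y2 & y3 & z1 & z2 & z3 & Ea & Eb & Ec & Ef & Eg & Eh).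
exists x1, x2, x3, (y1 - k * x1), (y2 - k * x2), (y3 - k * x3), z1, z2, z3.
repeat split; try assumption.
- replace b with ((b + 2 * k * h + k ^ 2 * a) - 2 * k * (h + k * a) + k ^ 2 * a) by ring.
  rewrite Eb, Eh, Ea; ring.
- replace f with ((f + k * g) - k * g) by ring; rewrite Ef, Eg; ring.
- replace h with ((h + k * a) - k * a) by ring; rewrite Eh, Ea; ring.
Qed.

Lemma is_gram_add13 k a b c f g h :
  is_gram a b (c + 2 * k * g + k ^ 2 * a) (f + k * h) (g + k * a) h ->
  is_gram a b c f g h.
Proof.
intro H; apply is_gram_swap23, (is_gram_add12 k), is_gram_swap23, H.
Qed.

Lemma is_gram_add23 k a b c f g h :
  is_gram a b (c + 2 * k * f + k ^ 2 * b) (f + k * b) (g + k * h) h ->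
  is_gram a b c f g h.
Proof.
intro H; apply is_gram_swap12, (is_gram_add13 k), is_gram_swap12, H.
Qed.

Lemma centered_residue (x m : Z) : 0 < m -> exists k, - m <= 2 * (x + k * m) <= m.
Proof.
intro Hm; exists (- ((2 * x + m) / (2 * m))).
pose proof (Z.div_mod (2 * x + m) (2 * m) ltac:(lia)).
pose proof (Z.mod_pos_bound (2 * x + m) (2 * m) ltac:(lia)).
nia.
Qed.

(** Gauss reduction, descending on [b]: once [2 * |f| <= b], either [c < b] and the variables are
    exchanged, or [b ^ 2 <= b * c = 1 + f ^ 2] forces [b = 1]. *)
Lemma binary_unimodular_is_gram : forall b c f : Z,
  0 < b -> b * c - f ^ 2 = 1 -> is_gram 1 b c f 0 0.
Proof.
intro b; pattern b.
apply (well_founded_induction (Z.lt_wf 0)); clear b; intros b IH c f Hb Hdet.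
destruct (centered_residue f b Hb) as [k Hk].
apply (is_gram_add23 k).
replace (0 + k * 0) with 0 by ring.
set (c' := c + 2 * k * f + k ^ 2 * b); set (f' := f + k * b) in *.
assert (Hdet' : b * c' - f' ^ 2 = 1) by (unfold c', f'; rewrite <- Hdet; ring).
clearbody c' f'; clear c f k Hdet.
assert (Hc : 0 < c') by nia.
destruct (Z_lt_le_dec c' b) as [Hlt | Hle].
- apply is_gram_swap23, IH; [lia | assumption | etransitivity; [| exact Hdet']; ring].
- assert (b = 1) by nia; assert (f' = 0) by lia; assert (c' = 1) by nia; subst.
  exists 1, 0, 0, 0, 1, 0, 0, 0, 1; repeat split; reflexivity.
Qed.

(** Descent on [a] and, for fixed [a], on the minor [P = a * b - h ^ 2]. When [P] cannot be lowered,
    it is so small that centering [h] makes the second diagonal entry smaller than [a]. *)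
Lemma ternary_unimodular_is_gram : forall a b c f g h : Z,
  0 < a -> 0 < a * b - h ^ 2 ->
  a * b * c + 2 * f * g * h - a * f ^ 2 - b * g ^ 2 - c * h ^ 2 = 1 ->
  is_gram a b c f g h.
Proof.
intro a; pattern a.
apply (well_founded_induction (Z.lt_wf 0)); clear a; intros a IHa b c f g h Ha.
remember (a * b - h ^ 2) as P eqn:EP; revert b c f g h EP.
pattern P; apply (well_founded_induction (Z.lt_wf 0)); clear P.
intros P IHP b c f g h EP HP Hdet.
destruct (Z.eq_dec a 1) as [-> | Ha1].
{ apply (is_gram_add12 (- h)), (is_gram_add13 (- g)).
  replace (h + - h * 1) with 0 by ring; replace (g + - g * 1) with 0 by ring.
  apply binary_unimodular_is_gram; [| etransitivity; [| exact Hdet]; ring].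
  replace (b + 2 * - h * h + (- h) ^ 2 * 1) with P by (rewrite EP; ring); exact HP. }
(* [P], [Q], [R] are the coefficients of the binary form [a A(x, y, z) - (a x + h y + g z)^2]. *)
destruct (centered_residue (a * f - g * h) P HP) as [k Hk].
apply (is_gram_add23 k).
set (c1 := c + 2 * k * f + k ^ 2 * b).
set (f1 := f + k * b); set (g1 := g + k * h).
assert (Hdet1 : a * b * c1 + 2 * f1 * g1 * h - a * f1 ^ 2 - b * g1 ^ 2 - c1 * h ^ 2 = 1)
  by (etransitivity; [| exact Hdet]; unfold c1, f1, g1; ring).
assert (HR : - P <= 2 * (a * f1 - g1 * h) <= P)
  by (replace (a * f1 - g1 * h) with (a * f - g * h + k * P)
        by (unfold f1, g1; rewrite EP; ring); exact Hk).
clearbody c1 f1 g1; clear c f g k Hk Hdet.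
set (R := a * f1 - g1 * h) in *.
set (Q := a * c1 - g1 ^ 2).
assert (HPQR : P * Q = a + R ^ 2).
{ transitivity (a * 1 + R ^ 2); [rewrite <- Hdet1, EP; unfold Q, R |]; ring. }
pose proof (Z.square_nonneg R) as HR2.
assert (HQ : 0 < Q) by (apply (Z.mul_pos_cancel_l P); [exact HP | lia]).
destruct (Z_lt_le_dec Q P) as [HQP | HPQ].
{ apply is_gram_swap23, (IHP Q); [lia | reflexivity | assumption |].
  etransitivity; [| exact Hdet1]; ring. }
assert (HRP : 4 * R ^ 2 <= P ^ 2) by (clear - HR; nia).
(* From [P <= Q] and [P * Q = a + R ^ 2] comes [P ^ 2 <= a + P ^ 2 / 4]. For [a >= 2] this gives
   [4 * P < 3 * a ^ 2], hence [a * b2 = P + h2 ^ 2 < a ^ 2] below. *)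
assert (H3P : 3 * P ^ 2 <= 4 * a) by (clear - HPQ HP HPQR HRP; nia).
assert (HPa : 4 * P < 3 * a ^ 2).
{ apply Z.nle_gt; intro Hle.
  assert (3 * (3 * a ^ 2) ^ 2 <= 64 * a) by (clear - H3P Hle Ha; nia).
  assert (8 <= a ^ 3) by (change 8 with (2 ^ 3); apply Z.pow_le_mono_l; lia).
  assert (a * (27 * a ^ 3) <= a * 64)
    by (replace (a * (27 * a ^ 3)) with (3 * (3 * a ^ 2) ^ 2) by ring; lia).
  assert (27 * a ^ 3 <= 64) by (apply (Z.mul_le_mono_pos_l _ _ a); assumption).
  lia. }
destruct (centered_residue h a Ha) as [j Hj].
apply (is_gram_add12 j), is_gram_swap12.
assert (Hprod : a * (b + 2 * j * h + j ^ 2 * a) = P + (h + j * a) ^ 2) by (rewrite EP; ring).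
set (b2 := b + 2 * j * h + j ^ 2 * a) in *.
assert (Hdet2 : b2 * a * c1 + 2 * g1 * (f1 + j * g1) * (h + j * a) - b2 * g1 ^ 2
    - a * (f1 + j * g1) ^ 2 - c1 * (h + j * a) ^ 2 = 1)
  by (etransitivity; [| exact Hdet1]; unfold b2; ring).
clearbody b2; set (h2 := h + j * a) in *; clearbody h2.
pose proof (Z.square_nonneg h2) as Hh2.
assert (Hh2a : 4 * h2 ^ 2 <= a ^ 2) by (clear - Hj; nia).
assert (Hb2 : 0 < b2) by (apply (Z.mul_pos_cancel_l a); [exact Ha | clear - Hprod HP Hh2; lia]).
apply IHa; [split; [clear - Hb2; lia | clear - Hprod HPa Hh2a Ha; nia] | assumption
  | clear - Hprod HP; lia | etransitivity; [| exact Hdet2]; ring].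
Qed.

(* The negative of the binary form [(d, H, C)] of determinant [n] is the square of a linear form
   modulo [n], so the binary form lifts to a ternary form of determinant 1 representing [n]. *)
Lemma three_squares_of_congruences n d s H C t k j :
  0 < n -> 0 < d -> d * C = H ^ 2 + n -> s * t = 1 + n * k -> s ^ 2 * d + 1 = n * j ->
  exists x y z, n = x ^ 2 + y ^ 2 + z ^ 2.
Proof.
intros Hn Hd HC Hst Hsd.
(* As [s] inverts [t] modulo [n], the numbers [- d], [- C], [- H] are congruent to [t ^ 2], [u ^ 2],
   [t * u]; [a], [b], [h] are the resulting quotients by [n]. *)
pose (u := - H * s); pose (h := - H * k); pose (b := C * j - s ^ 2).
pose (a := t ^ 2 * j - d * k * (2 + n * k)).
assert (Ea : n * a = d + t ^ 2).
{ transitivity (t ^ 2 * (n * j) - d * ((1 + n * k) ^ 2 - 1)); [unfold a; ring |].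
  rewrite <- Hsd, <- Hst; ring. }
assert (Eb : n * b = C + u ^ 2).
{ transitivity (C * (n * j) - n * s ^ 2); [unfold b; ring |].
  rewrite <- Hsd; transitivity (C + s ^ 2 * (d * C - n)); [ring |].
  rewrite HC; unfold u; ring. }
assert (Eh : n * h = H + t * u).
{ transitivity (H - H * (1 + n * k)); [unfold h; ring | rewrite <- Hst; unfold u; ring]. }
clearbody a b h u; clear s k j Hst Hsd.
assert (Hn' : d * C - H ^ 2 = n) by (rewrite HC; ring).
assert (Ha : 0 < a) by (apply (Z.mul_pos_cancel_l n); [assumption |];
  pose proof (Z.square_nonneg t); lia).
assert (Hab : 0 < a * b - h ^ 2).
(* The extra factor [d] completes the square in [t] and [u]. *)
{ apply (Z.mul_pos_cancel_l (d * n ^ 2));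
    [apply Z.mul_pos_pos; [| apply Z.pow_pos_nonneg]; easy |].
  replace (d * n ^ 2 * (a * b - h ^ 2)) with (d * ((n * a) * (n * b) - (n * h) ^ 2)) by ring.
  rewrite Ea, Eb, Eh.
  replace (d * ((d + t ^ 2) * (C + u ^ 2) - (H + t * u) ^ 2)) with
    (d * (d * C - H ^ 2) + (d * u - H * t) ^ 2 + (d * C - H ^ 2) * t ^ 2) by ring.
  rewrite Hn'.
  pose proof (Z.square_nonneg (d * u - H * t)) as Hsq.
  assert (Hdn : 0 < d * n) by (apply Z.mul_pos_pos; assumption).
  assert (Hnt : 0 <= n * t ^ 2)
    by (pose proof (Z.square_nonneg t); apply Z.mul_nonneg_nonneg; lia).
  clear - Hsq Hdn Hnt; lia. }
destruct (ternary_unimodular_is_gram a b n u t h Ha Hab)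
  as (x1 & x2 & x3 & y1 & y2 & y3 & z1 & z2 & z3 & _ & _ & Ez & _).
{ apply (Z.mul_reg_l _ _ n); [lia |].
  transitivity ((n * a) * (n * b) + 2 * (n * h) * t * u - (n * a) * u ^ 2 - (n * b) * t ^ 2
    - (n * h) ^ 2); [ring |].
  rewrite Ea, Eb, Eh.
  transitivity (d * C - H ^ 2); [ring | rewrite Hn'; ring]. }
exists z1, z2, z3; exact Ez.
Qed.

(** * The quaternary form *)

Definition represented (p : Z) : Prop :=
  exists a b c d : Z,
    a mod 5 = d mod 5 /\ b mod 5 = c mod 5 /\
    5 * p = a ^ 2 + 29 * b ^ 2 + c ^ 2 + 29 * d ^ 2.

(** Since [5 * (5 * u ^ 2 + 2 * u * w + 6 * w ^ 2) = (5 * u + w) ^ 2 + 29 * w ^ 2], each summand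
    supplies one pair of integers congruent modulo 5. *)
Lemma represented_binary_sum u1 w1 u2 w2 :
  represented (5 * u1 ^ 2 + 2 * u1 * w1 + 6 * w1 ^ 2
               + (5 * u2 ^ 2 + 2 * u2 * w2 + 6 * w2 ^ 2)).
Proof.
exists (w1 + u1 * 5), w2, (w2 + u2 * 5), w1.
rewrite !Z_mod_plus_full; repeat split; ring.
Qed.

Notation quad := (Z * Z * Z * Z)%type.

Definition norm4 (v : quad) : Z :=
  let '(a, b, c, d) := v in a ^ 2 + b ^ 2 + c ^ 2 + d ^ 2.

Definition cong29 (s : Z) (v w : quad) : Prop :=
  let '(a, b, c, d) := v in let '(a', b', c', d') := w in
  (29 | a - s * a') /\ (29 | b - s * b') /\ (29 | c - s * c') /\ (29 | d - s * d').

(* [12] is a square root of [-1] modulo [29]; the kernel is the image of [Z[i]^2] under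
   [(u, w) -> (2 u + i w, u + (1 - 2 i) w)], whose determinant [2 - 5 i] has norm [29]. *)
Definition hyperplane (v : quad) : Z :=
  let '(a, b, c, d) := v in a + 12 * b - 2 * c - 24 * d.

Lemma represented_hyperplane v : (29 | hyperplane v) -> represented (norm4 v).
Proof.
destruct v as [[[a b] c] d]; intros [k Hk]; cbn [norm4 hyperplane] in *.
(* With [z1 = a + i b] and [z2 = c + i d], inverting the embedding gives
   [w = (z1 - 2 z2) / (5 i - 2)] and [u = z2 - (1 - 2 i) w]; the division is carried out by
   [a - 2 c = 29 k - 12 (b - 2 d)]. *)
pose (w1 := - 2 * k + b - 2 * d); pose (w2 := - 5 * k + 2 * b - 4 * d).
pose (u1 := c - w1 - 2 * w2); pose (u2 := d - w2 + 2 * w1).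
replace (a ^ 2 + b ^ 2 + c ^ 2 + d ^ 2) with
  (5 * u1 ^ 2 + 2 * u1 * w1 + 6 * w1 ^ 2 + (5 * u2 ^ 2 + 2 * u2 * w2 + 6 * w2 ^ 2)).
- apply represented_binary_sum.
- replace a with (2 * u1 - w2) by (unfold u1, w1, w2; lia).
  replace b with (2 * u2 + w1) by (unfold u2, w1, w2; lia).
  replace c with (u1 + w1 + 2 * w2) by (unfold u1; lia).
  replace d with (u2 + w2 - 2 * w1) by (unfold u2; lia).
  ring.
Qed.

(* Up to the units of [Z[i]], which preserve the hyperplane, these are all signed permutations. *)
Definition signed_permutations (v : quad) : list quad :=
  let '(a, b, c, d) := v in
  flat_map (fun '(b, c, d) =>
      [(a, b, c, d); (a, b, d, c); (a, c, b, d); (a, c, d, b); (a, d, b, c); (a, d, c, b);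
       (b, c, a, d); (b, c, d, a); (b, d, a, c); (b, d, c, a); (c, d, a, b); (c, d, b, a)])
    [(b, c, d); (- b, c, d); (b, - c, d); (b, c, - d);
     (- b, - c, d); (- b, c, - d); (b, - c, - d); (- b, - c, - d)].

Definition good (v : quad) : bool :=
  existsb (fun x => hyperplane x mod 29 =? 0) (signed_permutations v).

Lemma represented_good v : good v = true -> represented (norm4 v).
Proof.
intro H; apply existsb_exists in H as (x & Hx & H0).
replace (norm4 v) with (norm4 x).
- apply represented_hyperplane, Z.mod_divide, Z.eqb_eq, H0; lia.
- clear H0; revert x Hx; apply Forall_forall.
  destruct v as [[[a b] c] d]; repeat (apply Forall_cons; [cbn [norm4]; ring |]); constructor.
Qed.

Lemma hyperplane_cong s v w :
  Z.gcd 29 s = 1 -> cong29 s v w -> (29 | hyperplane v) -> (29 | hyperplane w).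
Proof.
intros Hs; destruct v as [[[a b] c] d], w as [[[a' b'] c'] d'].
intros ([i Hi] & [j Hj] & [k Hk] & [l Hl]) [m Hm]; cbn [hyperplane] in *.
apply (Z.gauss 29 s); [| exact Hs].
exists (m - i - 12 * j + 2 * k + 24 * l); lia.
Qed.

Lemma good_cong s v w :
  Z.gcd 29 s = 1 -> cong29 s v w -> good v = true -> good w = true.
Proof.
intros Hs H; unfold good.
assert (Hvw : Forall2 (cong29 s) (signed_permutations v) (signed_permutations w)).
{ destruct v as [[[a b] c] d], w as [[[a' b'] c'] d']; destruct H as (Ha & Hb & Hc & Hd).
  assert (opp : forall x y, (29 | x - s * y) -> (29 | - x - s * - y))
    by (intros x y [k Hk]; exists (- k); lia).
  pose proof (opp _ _ Hb); pose proof (opp _ _ Hc); pose proof (opp _ _ Hd).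
  repeat (apply Forall2_cons; [repeat split; assumption |]); constructor. }
induction Hvw as [| x y l l' Hxy _ IH]; [trivial | simpl].
rewrite !orb_true_iff, !Z.eqb_eq, !Z.mod_divide by lia.
intros [Hx | Hl]; [left; exact (hyperplane_cong s x y Hs Hxy Hx) | right; exact (IH Hl)].
Qed.

(** * Reflections in vectors of norm 3 *)

Definition dot (v w : quad) : Z :=
  let '(a, b, c, d) := v in let '(a', b', c', d') := w in
  a * a' + b * b' + c * c' + d * d'.

Definition sub_scaled (v : quad) (t : Z) (w : quad) : quad :=
  let '(a, b, c, d) := v in let '(a', b', c', d') := w in
  (a - t * a', b - t * b', c - t * c', d - t * d').

(** One vector from each opposite pair, as [w] and [- w] define the same reflection. *)
Definition norm3_vectors : list quad :=
  [(0, 1, 1, 1); (0, 1, 1, -1); (0, 1, -1, 1); (0, 1, -1, -1);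
   (1, 0, 1, 1); (1, 0, 1, -1); (1, 0, -1, 1); (1, 0, -1, -1);
   (1, 1, 0, 1); (1, 1, 0, -1); (1, -1, 0, 1); (1, -1, 0, -1);
   (1, 1, 1, 0); (1, 1, -1, 0); (1, -1, 1, 0); (1, -1, -1, 0)].

Lemma norm4_reflection v w t :
  norm4 w = 3 -> dot v w = 3 * t -> norm4 (sub_scaled v (2 * t) w) = norm4 v.
Proof.
destruct v as [[[a b] c] d], w as [[[a' b'] c'] d'];
  cbn [norm4 dot sub_scaled]; intros Hw Hd.
transitivity (a ^ 2 + b ^ 2 + c ^ 2 + d ^ 2
  - 4 * t * (a * a' + b * b' + c * c' + d * d')
  + 4 * t ^ 2 * (a' ^ 2 + b' ^ 2 + c' ^ 2 + d' ^ 2)); [ring |].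
rewrite Hw, Hd; ring.
Qed.

(* Since [20 = 2 / 3] modulo [29], this decides whether the reflection of [v] in [w] is good. *)
Definition good_reflection (v w : quad) : bool := good (sub_scaled v (20 * dot v w) w).

Lemma represented_good_reflection v w :
  In w norm3_vectors -> (3 | dot v w) -> good_reflection v w = true ->
  represented (norm4 v).
Proof.
intros Hw [t Ht] Hgood.
assert (Hw3 : norm4 w = 3)
  by (clear - Hw; revert w Hw; apply Forall_forall; repeat constructor).
rewrite <- (norm4_reflection v w t Hw3) by lia.
apply represented_good; refine (good_cong 1 _ _ eq_refl _ Hgood).
rewrite Ht; destruct v as [[[a b] c] d], w as [[[a' b'] c'] d']; cbn [sub_scaled cong29].
repeat split; [exists (- 2 * t * a') | exists (- 2 * t * b') | exists (- 2 * t * c')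
  | exists (- 2 * t * d')]; ring.
Qed.

(** * Reduction to a finite check modulo 29 and 3 *)

Definition reduce (m : Z) (v : quad) : quad :=
  let '(a, b, c, d) := v in (a mod m, b mod m, c mod m, d mod m).

Lemma good_reflection_cong s v u w :
  Z.gcd 29 s = 1 -> cong29 s v u ->
  good_reflection v w = true -> good_reflection u w = true.
Proof.
intros Hs H; apply (good_cong s _ _ Hs).
destruct v as [[[a b] c] d], u as [[[a' b'] c'] d'], w as [[[x y] z] t].
destruct H as ([i Hi] & [j Hj] & [k Hk] & [l Hl]); cbn [dot sub_scaled cong29].
replace a with (s * a' + i * 29) by lia; replace b with (s * b' + j * 29) by lia.
replace c with (s * c' + k * 29) by lia; replace d with (s * d' + l * 29) by lia.
pose (e := 20 * (i * x + j * y + k * z + l * t)).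
repeat split; [exists (i - e * x) | exists (j - e * y) | exists (k - e * z)
  | exists (l - e * t)]; unfold e; ring.
Qed.

Lemma dot_reduce3 v w : dot (reduce 3 v) w mod 3 = dot v w mod 3.
Proof.
destruct v as [[[a b] c] d], w as [[[a' b'] c'] d']; cbn [reduce dot].
rewrite (Z.mod_eq a 3), (Z.mod_eq b 3), (Z.mod_eq c 3), (Z.mod_eq d 3) by lia.
symmetry; etransitivity; [| apply (Z_mod_plus_full _ (a / 3 * a' + b / 3 * b' + c / 3 * c' + d / 3 * d'))].
f_equal; ring.
Qed.

Definition range (n : nat) : list Z := map Z.of_nat (seq 0 n).

Lemma in_range n x : 0 <= x < Z.of_nat n -> In x (range n).
Proof.
intro H; unfold range; rewrite <- (Z2Nat.id x) by lia.
apply in_map, in_seq; lia.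
Qed.

Definition residues3 : list quad :=
  let r := range 3 in list_prod (list_prod (list_prod r r) r) r.

Lemma reduce3_in v : In (reduce 3 v) residues3.
Proof.
destruct v as [[[a b] c] d]; unfold residues3; cbn [reduce].
repeat apply in_prod; apply in_range, Z.mod_pos_bound; lia.
Qed.

(** Here [v] is known only modulo 29. That decides which reflections are good, while their
    integrality depends on the vector modulo 3; so every residue modulo 3 must admit a good
    reflection. *)
Definition solvable (v : quad) : bool :=
  if good v then true else
  let l := filter (good_reflection v) norm3_vectors in
  forallb (fun m => existsb (fun w => dot m w mod 3 =? 0) l) residues3.

Lemma represented_solvable s u v :
  Z.gcd 29 s = 1 -> cong29 s u v -> solvable u = true -> represented (norm4 v).
Proof.
intros Hs Huv; unfold solvable; destruct (good u) eqn:H; [intros _ | clear H; intro H].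
{ exact (represented_good v (good_cong s u v Hs Huv H)). }
rewrite forallb_forall in H; specialize (H _ (reduce3_in v)).
apply existsb_exists in H as (w & Hw & H3); apply filter_In in Hw as [Hw Hgood].
apply (represented_good_reflection v w Hw);
  [| exact (good_reflection_cong s u v w Hs Huv Hgood)].
apply Z.eqb_eq in H3; rewrite dot_reduce3 in H3; apply Z.mod_divide; [lia | exact H3].
Qed.

(** For norm [e] modulo 29 the sum of the first two coordinates is prescribed to be [2 * e], which
    determines the second one. *)
Definition solvable_residue (e a c d : Z) : bool :=
  let v := (a, (2 * e - a) mod 29, c, d) in
  if norm4 v mod 29 =? e then solvable v else true.

Lemma solvable_residues :
  forallb (fun e => forallb (fun a => forallb (fun c => forallb (fun d =>
    solvable_residue e a c d) (range 29)) (range 29)) (range 29)) [1; 2] = true.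
Proof. vm_cast_no_check (eq_refl true). Qed.

(* Every residue is a square or twice a square modulo [29], and everything is homogeneous. *)
Lemma scaling_residue n : n mod 29 <> 0 ->
  exists s e w, Z.gcd 29 s = 1 /\ In e [1; 2] /\ 0 <= w < 29 /\
    s ^ 2 * n mod 29 = e /\ (29 | s * w - 2 * e).
Proof.
intro Hn.
assert (H : forallb (fun n => (n =? 0) || existsb (fun '(s, e, w) =>
    (Z.gcd 29 s =? 1) && (s ^ 2 * n mod 29 =? e) && ((s * w - 2 * e) mod 29 =? 0))
    (list_prod (list_prod (range 29) [1; 2]) (range 29))) (range 29) = true)
  by (vm_compute; reflexivity).
rewrite forallb_forall in H.
specialize (H (n mod 29) (in_range 29 _ (Z.mod_pos_bound n 29 ltac:(lia)))).
apply orb_true_iff in H as [H | H]; [apply Z.eqb_eq in H; contradiction |].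
apply existsb_exists in H as ([[s e] w] & Hin & H).
apply in_prod_iff in Hin as [Hin Hw]; apply in_prod_iff in Hin as [_ He].
apply in_map_iff in Hw as (w' & <- & Hw); apply in_seq in Hw.
rewrite !andb_true_iff, !Z.eqb_eq in H; destruct H as [[Hs Hse] Hsw].
exists s, e, (Z.of_nat w'); repeat split; try assumption; try lia.
- rewrite <- Hse; symmetry; apply Zmult_mod_idemp_r.
- apply Z.mod_divide; [lia | exact Hsw].
Qed.

Lemma represented_of_sum s e a b c d :
  Z.gcd 29 s = 1 -> In e [1; 2] -> s ^ 2 * norm4 (a, b, c, d) mod 29 = e ->
  (29 | s * (a + b) - 2 * e) -> represented (norm4 (a, b, c, d)).
Proof.
set (v := (a, b, c, d)); intros Hs He Hn [k Hk].
set (u := ((s * a) mod 29, (2 * e - (s * a) mod 29) mod 29, (s * c) mod 29, (s * d) mod 29)).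
assert (Hmod : forall x, exists q, x mod 29 = x + q * 29)
  by (intro x; exists (- (x / 29)); rewrite (Z.mod_eq x 29); lia).
assert (Huv : cong29 s u v).
{ unfold u, v; rewrite Zminus_mod_idemp_r; repeat split.
  - destruct (Hmod (s * a)) as [q ->]; exists q; lia.
  - destruct (Hmod (2 * e - s * a)) as [q ->]; exists (q - k); lia.
  - destruct (Hmod (s * c)) as [q ->]; exists q; lia.
  - destruct (Hmod (s * d)) as [q ->]; exists q; lia. }
apply (represented_solvable s u v Hs Huv).
pose proof solvable_residues as H; rewrite forallb_forall in H; specialize (H e He).
assert (mod_in : forall x, In (x mod 29) (range 29))
  by (intro x; apply in_range, Z.mod_pos_bound; lia).
rewrite forallb_forall in H; specialize (H _ (mod_in (s * a))).
rewrite forallb_forall in H; specialize (H _ (mod_in (s * c))).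
rewrite forallb_forall in H; specialize (H _ (mod_in (s * d))).
unfold solvable_residue in H; fold u in H.
replace (norm4 u mod 29) with e in H; [rewrite Z.eqb_refl in H; exact H |].
rewrite <- Hn; clearbody u; clear - Huv.
destruct u as [[[a' b'] c'] d']; destruct Huv as ([i Hi] & [j Hj] & [m Hm] & [l Hl]).
cbn [norm4 v].
replace a' with (s * a + i * 29) by lia; replace b' with (s * b + j * 29) by lia.
replace c' with (s * c + m * 29) by lia; replace d' with (s * d + l * 29) by lia.
symmetry; etransitivity; [| apply (Z_mod_plus_full _
  (i * (2 * s * a + 29 * i) + j * (2 * s * b + 29 * j) + m * (2 * s * c + 29 * m)
   + l * (2 * s * d + 29 * l)))].
f_equal; ring.
Qed.

(** * Primes up to 421 *)

Definition small_values : list Z :=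
  let r := map (fun x => x - 9) (range 19) in
  filter (fun x => x <=? 421)
    (map (fun '(x, y) => 5 * x ^ 2 + 2 * x * y + 6 * y ^ 2) (list_prod r r)).

(** The divisors listed are the primes below the square root of 421. The binary form is at least
    [29 / 6 * x ^ 2] and [29 / 5 * y ^ 2], so coordinates up to 9 yield all its values up to 421. *)
Definition small_check (p : Z) : bool :=
  existsb (fun d => (d <? p) && (p mod d =? 0)) [2; 3; 5; 7; 11; 13; 17; 19]
  || existsb (Z.eqb p) [0; 1; 2; 3; 7; 17; 23]
  || (let l := small_values in existsb (fun x => existsb (Z.eqb (p - x)) l) l).

Lemma small_checks : forallb small_check (range 422) = true.
Proof. vm_cast_no_check (eq_refl true). Qed.

Lemma represented_small p :
  prime p -> p <= 421 -> p <> 2 -> p <> 3 -> p <> 7 -> p <> 17 -> p <> 23 -> represented p.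
Proof.
intros Hp Hle H2 H3 H7 H17 H23; pose proof (prime_ge_2 p Hp) as Hge.
pose proof small_checks as H; rewrite forallb_forall in H.
specialize (H p (in_range 422 p ltac:(lia))); unfold small_check in H.
apply orb_true_iff in H as [H | H]; [apply orb_true_iff in H as [H | H] |].
- apply existsb_exists in H as (d & Hd & H); apply andb_true_iff in H as [Hlt Hmod].
  apply Z.ltb_lt in Hlt; apply Z.eqb_eq in Hmod.
  assert (1 < d) by (clear - Hd; revert d Hd; apply Forall_forall; repeat constructor).
  apply Z.mod_divide in Hmod; [| lia].
  destruct (prime_divisors p Hp d Hmod) as [? | [? | [? | ?]]]; lia.
- apply existsb_exists in H as (d & Hd & H); apply Z.eqb_eq in H; subst d.
  simpl in Hd; intuition lia.
- apply existsb_exists in H as (x & Hx & H); apply existsb_exists in H as (y & Hy & H).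
  apply Z.eqb_eq in H; replace p with (x + y) by lia.
  apply filter_In in Hx as [Hx _]; apply in_map_iff in Hx as ([u1 w1] & <- & _).
  apply filter_In in Hy as [Hy _]; apply in_map_iff in Hy as ([u2 w2] & <- & _).
  apply represented_binary_sum.
Qed.

(** * Primes above 421, by way of three squares *)

Lemma odd_residue r : 0 <= r < 29 -> exists w, Z.Odd w /\ - 29 <= w <= 29 /\ (29 | w - r).
Proof.
intro Hr; destruct (Z.Even_or_Odd r) as [[k Hk] | Hodd].
- exists (r - 29); repeat split; [exists (k - 15); lia | lia | lia | exists (-1); lia].
- exists r; repeat split; [assumption | lia | lia | exists 0; lia].
Qed.

(** The number of odd coordinates is odd; besides one odd coordinate the other two then have equal
    parity. *)
Lemma odd_sum_three_squares x y z : Z.Odd (x ^ 2 + y ^ 2 + z ^ 2) ->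
  exists x' y' z', x ^ 2 + y ^ 2 + z ^ 2 = x' ^ 2 + y' ^ 2 + z' ^ 2
    /\ Z.Odd x' /\ Z.Even (y' + z').
Proof.
assert (Hodd : forall t, Z.odd (t ^ 2) = Z.odd t)
  by (intro t; rewrite Z.pow_2_r, Z.odd_mul; apply andb_diag).
rewrite <- Z.odd_spec, !Z.odd_add, !Hodd; intro H.
destruct (Z.odd x) eqn:Hx; [| destruct (Z.odd y) eqn:Hy].
- exists x, y, z; rewrite <- Z.odd_spec, <- Z.even_spec, <- Z.negb_odd, Z.odd_add.
  repeat split; [assumption | destruct (Z.odd y), (Z.odd z); easy].
- exists y, x, z; rewrite <- Z.odd_spec, <- Z.even_spec, <- Z.negb_odd, Z.odd_add, Hx.
  repeat split; [ring | assumption | destruct (Z.odd z); easy].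
- exists z, x, y; rewrite <- Z.odd_spec, <- Z.even_spec, <- Z.negb_odd, Z.odd_add, Hx, Hy.
  repeat split; [ring | exact H].
Qed.

(* [2 p - w^2] is 1 modulo 4 for odd [w], so a single case of the three-square theorem suffices. *)
Lemma represented_large
  (three_squares : forall n, 0 < n -> n mod 4 = 1 -> exists x y z, n = x ^ 2 + y ^ 2 + z ^ 2) p :
  prime p -> 421 < p -> represented p.
Proof.
intros Hp Hlt.
assert (Hp29 : p mod 29 <> 0).
{ intro Hdiv; apply Z.mod_divide in Hdiv; [| lia].
  destruct (prime_divisors p Hp _ Hdiv) as [? | [? | [? | ?]]]; lia. }
assert (Hpodd : p mod 2 = 1).
{ destruct (Z.mod_pos_bound p 2 ltac:(lia)) as [? ?].
  assert (p mod 2 <> 0); [| lia].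
  intro Hdiv; apply Z.mod_divide in Hdiv; [| lia].
  destruct (prime_divisors p Hp _ Hdiv) as [? | [? | [? | ?]]]; lia. }
destruct (scaling_residue p Hp29) as (s & e & w0 & Hs & He & Hw0 & Hse & [m Hm]).
destruct (odd_residue w0 Hw0) as (w & [k Hk] & Hw & [l Hl]).
destruct (three_squares (2 * p - w ^ 2)) as (x & y & z & Hxyz).
(* The source of the bound 421: [w ^ 2 <= 29 ^ 2 = 841 < 2 * p]. *)
{ nia. }
{ pose proof (Z.div_mod p 2 ltac:(lia)) as H.
  replace (2 * p - w ^ 2) with (1 + (p / 2 - k ^ 2 - k) * 4) by (clear - Hk Hpodd H; rewrite Hk; lia).
  rewrite Z_mod_plus_full; reflexivity. }
assert (Hodd : Z.Odd (2 * p - w ^ 2)) by (exists (p - 2 * k ^ 2 - 2 * k - 1); rewrite Hk; ring).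
rewrite Hxyz in Hodd; apply odd_sum_three_squares in Hodd; rewrite <- Hxyz in Hodd.
clear x y z Hxyz; destruct Hodd as (x & y & z & Hxyz & [x' Hx] & [y' Hy]).
(* The coordinates are [(w + x) / 2], [(w - x) / 2], [(y + z) / 2], [(y - z) / 2]: the first two add
   up to [w], and the norm is half of [w ^ 2 + x ^ 2 + y ^ 2 + z ^ 2 = 2 * p]. *)
assert (Hnorm : norm4 (k + x' + 1, k - x', y', y' - z) = p).
{ clear - Hxyz Hk Hx Hy; apply (Z.mul_reg_l _ _ 2); [lia | cbn [norm4]].
  transitivity ((2 * k + 1) ^ 2 + ((2 * x' + 1) ^ 2 + (2 * y' - z) ^ 2 + z ^ 2)); [ring |].
  replace (2 * y' - z) with y by lia; rewrite <- Hk, <- Hx, <- Hxyz; ring. }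
rewrite <- Hnorm; apply (represented_of_sum s e); try assumption; [rewrite Hnorm; assumption |].
replace (k + x' + 1 + (k - x')) with w by (clear - Hk; lia).
clear - Hl Hm; exists (m + s * l); replace w with (w0 + l * 29) by lia; lia.
Qed.

(** * Real characters and divisor sums *)

From HB Require Import structures.
From mathcomp Require Import all_boot all_order all_algebra.
From mathcomp Require Import all_fingroup all_solvable all_field realalg.
From mathcomp Require Import zify ring lra.
Set Implicit Arguments.
Unset Strict Implicit.
Unset Printing Implicit Defensive.
Import Order.TTheory GRing.Theory Num.Theory.
Local Open Scope ring_scope.

(** * Summation by parts *)

Section Abel.
Variable R : realFieldType.
Implicit Types (u f : nat -> R) (C : R).

(** The variation of [f] telescopes to [C * (f M - f K)]; the boundary terms add [C * f K] and
    [C * f M]. *)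
Lemma abel_sum_bound u f C M K :
  (forall n, `|\sum_(0 <= i < n) u i| <= C) ->
  (forall i j, (0 < i <= j)%N -> 0 <= f j <= f i) -> (0 < M <= K)%N ->
  `|\sum_(M <= k < K) u k * f k| <= 2 * C * f M.
Proof.
move=> uC f_mono /andP[M_gt0 leMK].
pose U n := \sum_(0 <= i < n) u i.
have C_ge0 : 0 <= C by apply: le_trans (uC 0%N).
have fP i : (0 < i)%N -> 0 <= f i by move=> i_gt0; have := f_mono i i; rewrite i_gt0 leqnn => /(_ isT)/andP[].
have main : `|\sum_(M <= k < K) u k * f k - U K * f K + U M * f M| <= C * (f M - f K).
  elim: K leMK => [|K IH]; first by move=> leM0; exfalso; lia.
  rewrite leq_eqVlt => /orP[/eqP <-|].
    by rewrite big_geq // add0r addNr normr0 subrr mulr0.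
  rewrite ltnS => leMK; have K_gt0 : (0 < K)%N by apply: leq_trans leMK.
  have := f_mono K K.+1 _; rewrite K_gt0 leqnSn => /(_ isT)/andP[_ lef].
  have -> : \sum_(M <= k < K.+1) u k * f k - U K.+1 * f K.+1 + U M * f M =
      (\sum_(M <= k < K) u k * f k - U K * f K + U M * f M) + U K.+1 * (f K - f K.+1).
    by rewrite big_nat_recr //= /U big_nat_recr //=; ring.
  have -> : C * (f M - f K.+1) = C * (f M - f K) + C * (f K - f K.+1) by ring.
  apply: le_trans (ler_normD _ _) (lerD (IH leMK) _).
  by rewrite normrM (ger0_norm (_ : 0 <= f K - f K.+1)) ?subr_ge0 // ler_wpM2r ?subr_ge0 ?uC.
have K_gt0 : (0 < K)%N by apply: leq_trans leMK.
have -> : \sum_(M <= k < K) u k * f k =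
   (\sum_(M <= k < K) u k * f k - U K * f K + U M * f M) + U K * f K - U M * f M by ring.
have -> : 2 * C * f M = C * (f M - f K) + C * f K + C * f M by ring.
apply: le_trans (ler_normB _ _) _; apply: lerD.
  apply: le_trans (ler_normD _ _) (lerD main _).
  by rewrite normrM (ger0_norm (fP _ _)) //; apply: ler_wpM2r; [apply: fP | apply: uC].
by rewrite normrM (ger0_norm (fP _ _)) //; apply: ler_wpM2r; [apply: fP | apply: uC].
Qed.

(** Full periods cancel and fewer than [N] terms remain. *)
Lemma periodic_sum_bound u C N n :
  (0 < N)%N -> (forall i, u (i + N)%N = u i) -> \sum_(0 <= i < N) u i = 0 ->
  (forall i, `|u i| <= C) -> `|\sum_(0 <= i < n) u i| <= N%:R * C.
Proof.
move=> N_gt0 uN sumN uC.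
have C_ge0 : 0 <= C by apply: le_trans (uC 0%N).
have uNq i q : u (i + q * N)%N = u i.
  by elim: q => [|q IH]; rewrite ?addn0 // mulSn [(N + _)%N]addnC addnA uN.
have per q : \sum_(0 <= i < q * N) u i = 0.
  elim: q => [|q IH]; first by rewrite big_geq.
  rewrite mulSnr (@big_cat_nat _ _ _ (q * N)%N) ?leq_addr //= IH add0r.
  rewrite -{1}[(q * N)%N]add0n big_addn addKn -[RHS]sumN.
  by apply: eq_bigr => i _; rewrite uNq.
rewrite {1}(divn_eq n N) (@big_cat_nat _ _ _ (n %/ N * N)%N) ?leq_addr //= per add0r.
rewrite -{1}[(_ * N)%N]add0n big_addn addKn.
apply: le_trans (ler_norm_sum _ _ _) _.
apply: (@le_trans _ _ (\sum_(0 <= i < n %% N) C)); first by apply: ler_sum => i _.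
rewrite sumr_const_nat subn0 -[C *+ _]mulr_natl; apply: ler_wpM2r => //.
by rewrite ler_nat ltnW // ltn_mod.
Qed.

End Abel.

(** * Inverse square roots, hyperbola method, harmonic series *)

Section InvSqrt.
Variable R : rcfType.

Definition invsqrt (n : nat) : R := (Num.sqrt n%:R)^-1.

Lemma invsqrtM a b : invsqrt (a * b) = invsqrt a * invsqrt b.
Proof. by rewrite /invsqrt natrM sqrtrM ?ler0n // invfM. Qed.

Lemma invsqrt_sqr a : invsqrt (a ^ 2) = a%:R^-1.
Proof. by rewrite /invsqrt natrX sqrtr_sqr ger0_norm ?ler0n. Qed.

Lemma invsqrt_ge0 a : 0 <= invsqrt a.
Proof. by rewrite invr_ge0 sqrtr_ge0. Qed.

Lemma invsqrt_mono a b : (0 < a <= b)%N -> 0 <= invsqrt b <= invsqrt a.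
Proof.
case/andP=> a_gt0 leab; have b_gt0 := leq_trans a_gt0 leab.
have pos n : (0 < n)%N -> 0 < Num.sqrt (n%:R : R) by rewrite sqrtr_gt0 ltr0n.
by rewrite invsqrt_ge0 lef_pV2 ?posrE ?pos // ler_wsqrtr // ler_nat.
Qed.

Lemma invsqrt1 : invsqrt 1 = 1.
Proof. by rewrite /invsqrt sqrtr1 invr1. Qed.

End InvSqrt.

(** Every point below the hyperbola has [a <= Y] or [b <= Y]. By symmetry both parts have equal
    sums, and they overlap in the square. *)
Lemma hyperbola_sum (V : zmodType) (t : nat -> nat -> V) Y :
  (forall a b, t a b = t b a) ->
  \sum_(1 <= b < (Y ^ 2).+1) \sum_(1 <= a < (Y ^ 2).+1 | (a * b <= Y ^ 2)%N) t a b =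
  (\sum_(1 <= b < Y.+1) \sum_(1 <= a < (Y ^ 2).+1 | (a * b <= Y ^ 2)%N) t a b) *+ 2
  - \sum_(1 <= b < Y.+1) \sum_(1 <= a < Y.+1) t a b.
Proof.
move=> tC; set X := (Y ^ 2)%N.
have EX : X = (Y * Y)%N by rewrite mulnn.
have leYX : (Y <= X)%N by rewrite EX; nia.
rewrite (@big_cat_nat _ _ _ Y.+1) //= mulr2n -addrA; congr (_ + _).
apply/eqP; rewrite -subr_eq opprK; apply/eqP.
transitivity (\sum_(Y.+1 <= b < X.+1) \sum_(1 <= a < Y.+1 | (a * b <= X)%N) t a b
  + \sum_(1 <= b < Y.+1) \sum_(1 <= a < Y.+1) t a b).
  congr (_ + _); apply: eq_big_nat => b /andP[ltYb _].
  rewrite (@big_cat_nat _ _ _ Y.+1) //= [X in _ + X]big_nat_cond [X in _ + X]big_pred0 ?addr0 //.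
  by move=> a; rewrite EX; nia.
rewrite [X in X + _](exchange_big_dep_nat xpredT) //= -big_split /=.
apply: eq_big_nat => b /andP[b_gt0 lebY].
rewrite addrC [RHS](@big_cat_nat _ _ _ Y.+1) //=; congr (_ + _).
  rewrite [RHS]big_nat_cond [LHS]big_nat_cond.
  apply: eq_big => [a|a _ //].
  by rewrite EX; nia.
by apply: eq_big => [a|a _]; rewrite 1?mulnC // tC.
Qed.

Lemma harmonic_unbounded (R : archiRealFieldType) (C : R) :
  exists n, C < \sum_(0 <= i < n) i.+1%:R^-1.
Proof.
have H k : k%:R / 2 <= \sum_(0 <= i < 2 ^ k) i.+1%:R^-1 :> R.
  elim: k => [|k IH]; first by rewrite mul0r; apply: sumr_ge0 => i _; rewrite invr_ge0.
  rewrite expnS mul2n -addnn (@big_cat_nat _ _ _ (2 ^ k)%N) ?leq_addr //=.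
  rewrite -natr1 mulrDl; apply: lerD => //.
  apply: (@le_trans _ _ (\sum_(2 ^ k <= i < 2 ^ k + 2 ^ k) (2 ^ k.+1)%:R^-1)).
    rewrite sumr_const_nat addnK -[_%:R^-1 *+ _]mulr_natl expnS natrM invfM mulrCA.
    have nz : (2 ^ k)%:R != 0 :> R by rewrite pnatr_eq0 expn_eq0.
    by rewrite mulfV // mulr1 mul1r.
  apply: ler_sum_nat => i /andP[_ lti]; rewrite lef_pV2 ?posrE ?ltr0n ?expn_gt0 //.
  by rewrite ler_nat expnS mul2n -addnn.
have [k ltk] : exists k : nat, C * 2 < k%:R.
  exists (Num.bound `|C * 2|).
  exact: le_lt_trans (ler_norm _) (archi_boundP (normr_ge0 _)).
by exists (2 ^ k)%N; apply: lt_le_trans (H k); rewrite ltr_pdivlMr.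
Qed.

Lemma sum_squares_le (R : numDomainType) (G : nat -> R) (K : nat -> nat) J :
  (forall m, 0 <= G m) -> (forall j, K j < K j.+1)%N ->
  \sum_(0 <= j < J) G (K j.+1) <= \sum_(1 <= m < (K J).+1) G m.
Proof.
move=> G_ge0 K_mono; elim: J => [|J IH]; first by rewrite big_geq //; apply: sumr_ge0.
rewrite big_nat_recr //= big_nat_recr ?(leq_ltn_trans (leq0n (K J))) //=; apply: lerD => //.
apply: le_trans IH _; rewrite [leRHS](@big_cat_nat _ _ _ (K J).+1) //=.
by rewrite lerDl; apply: sumr_ge0.
Qed.

Lemma modn_inverse b N : (0 < N)%N -> coprime b N ->
  exists b', b * b' = 1 %[mod N].
Proof.
move=> N_gt0 coNb; have [a _ /dvdnP[q]] := Bezoutl b N_gt0.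
(* Bezout gives [a * b = -1] modulo [N]; multiplying [a] by [N.-1] corrects the sign without
   subtraction. *)
rewrite gcdnC (eqP coNb) => Hq; exists (a * N.-1)%N.
rewrite -(modnMDl q) -[RHS](modnMDl (a * b)); congr (_ %% _)%N.
by rewrite -Hq; nia.
Qed.

(** * Comparison of two residue classes modulo [N] *)

Section ResidueClasses.
Variables (R : archiRcfType) (N : nat) (chi : nat -> int) (eps : nat).
Hypothesis N_gt0 : (0 < N)%N.
Hypothesis chiM : forall a b, chi (a * b)%N = chi a * chi b.
Hypothesis chi_mod : forall a, chi (a %% N)%N = chi a.
Hypothesis chi_sqr : forall a, chi a ^+ 2 = (coprime a N)%:R.
Hypothesis chi_eps : chi eps = 1.

Local Notation f := (@invsqrt R).
Local Notation x := (fun b => (chi b)%:~R : R).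

Definition residue_diff (b k : nat) : R :=
  (b * k == eps %[mod N])%:R - (b * k == 1 %[mod N])%:R.
Local Notation delta := residue_diff.

Lemma residue_diffC b k : delta b k = delta k b.
Proof. by rewrite /delta mulnC. Qed.

Lemma chi1 : chi 1 = 1.
Proof. by have := chiM 1 eps; rewrite mul1n chi_eps mulr1 => <-. Qed.

(** Where [delta b k] is nonzero, [b * k] is [eps] or 1 modulo [N], so [chi b * chi k = 1], and
    values with square 0 or 1 must then agree. *)
Lemma chi_residue_diff b k : x b * delta b k = x k * delta b k.
Proof.
have H e : chi e = 1 -> b * k = e %[mod N] -> chi b = chi k.
  move=> chi_e bke; have bk1 : chi b * chi k = 1 by rewrite -chiM -chi_mod bke chi_mod.
  have := chi_sqr b; case: (coprime b N) => chib2.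
    by rewrite -[RHS]mul1r -[1]/(true%:R) -chib2 expr2 -mulrA bk1 mulr1.
  have := oner_neq0 int; rewrite -bk1; move/eqP: chib2; rewrite sqrf_eq0 => /eqP ->.
  by rewrite mul0r eqxx.
rewrite /delta.
case: eqP => [/(H _ chi_eps) ->//|_]; case: eqP => [/(H _ chi1) ->//|_].
by rewrite subrr !mulr0.
Qed.

Lemma count_residue b e : coprime b N ->
  \sum_(0 <= k < N) (b * k == e %[mod N])%:R = 1 :> R.
Proof.
move=> /(modn_inverse N_gt0)[b' bb'].
have lt0 : (b' * e %% N < N)%N by rewrite ltn_mod.
rewrite big_mkord (bigD1 (Ordinal lt0)) //= big1 ?addr0.
  by rewrite modnMmr mulnA -modnMml bb' modnMml mul1n eqxx.
move=> k /eqP neq; case: eqP => // bk; case: neq; apply: val_inj => /=.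
rewrite -modnMmr -bk modnMmr mulnA [(b' * b)%N]mulnC -modnMml bb' modnMml mul1n.
by rewrite modn_small.
Qed.

Lemma sum_residue_diff b : coprime b N -> \sum_(0 <= k < N) delta b k = 0.
Proof. by move=> coNb; rewrite sumrB !count_residue ?subrr. Qed.

Lemma residue_diff_period b k : delta b (k + N)%N = delta b k.
Proof. by rewrite /delta mulnDr addnC modnMDl. Qed.

Lemma residue_diff_bound b k : `|delta b k| <= 1.
Proof.
by rewrite /delta; do 2!case: eqP => _; rewrite ?subrr ?subr0 ?sub0r ?normrN ?normr0 ?normr1.
Qed.

Definition partial_diff (b Z : nat) : R := \sum_(1 <= k < Z.+1) delta b k * f k.
Local Notation D := partial_diff.

Lemma residue_diff_abel b M K : coprime b N -> (0 < M <= K)%N ->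
  `|\sum_(M <= k < K) delta b k * f k| <= 2 * N%:R * f M.
Proof.
move=> coNb MK; apply: abel_sum_bound => // [n|i j]; last exact: invsqrt_mono.
rewrite -[N%:R]mulr1; apply: periodic_sum_bound => //.
- exact: residue_diff_period.
- exact: sum_residue_diff.
- exact: residue_diff_bound.
Qed.

Lemma partial_diff_bound b Z : coprime b N -> `|D b Z| <= 2 * N%:R.
Proof.
by move=> coNb; have := @residue_diff_abel b 1 Z.+1 coNb isT; rewrite invsqrt1 mulr1.
Qed.

Lemma partial_diff_cauchy b Z X : coprime b N -> (Z <= X)%N ->
  `|D b Z - D b X| <= 2 * N%:R * f Z.+1.
Proof.
move=> coNb leZX; rewrite distrC /D.
rewrite [in X in X - _](@big_cat_nat _ _ _ Z.+1) //= addrAC subrr add0r.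
exact: residue_diff_abel.
Qed.

Lemma chi_not_coprime b : ~~ coprime b N -> chi b = 0.
Proof.
move/negbTE=> ncoNb; have := chi_sqr b; rewrite ncoNb => /eqP.
by rewrite sqrf_eq0 => /eqP.
Qed.

Lemma chi_norm_le1 b : `|x b| <= 1.
Proof.
have := chi_sqr b; rewrite -(@ler_pXn2r _ 2) ?nnegrE ?ler01 // -normrX -rmorphXn /= => ->.
by case: coprime; rewrite ?normr1 ?normr0 expr1n ?ler01 ?lexx.
Qed.

(** The factor [x b * D b Z] is periodic in [b] and bounded by [2 * N]. It has mean zero: after
    exchanging the sums, [chi_residue_diff] moves the character to [k], and [delta k b] sums to zero
    over [b]. Summation by parts applies. *)
Lemma sum_chi_partial_diff Z Y :
  `|\sum_(1 <= b < Y.+1) x b * D b Z * f b| <= 4 * N%:R ^+ 2.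
Proof.
have -> : 4 * N%:R ^+ 2 = 2 * (N%:R * (2 * N%:R)) * f 1 by rewrite invsqrt1; ring.
apply: abel_sum_bound => [n|i j|//]; last exact: invsqrt_mono.
apply: periodic_sum_bound => // [b||b].
- rewrite -chi_mod modnDr chi_mod; congr (_ * _); apply: eq_bigr => k _.
  by rewrite residue_diffC residue_diff_period residue_diffC.
- under eq_bigr => b _ do rewrite mulr_sumr.
  rewrite exchange_big /= big1 // => k _.
  have -> : \sum_(0 <= b < N) x b * (delta b k * f k) = x k * f k * \sum_(0 <= b < N) delta k b.
    rewrite mulr_sumr; apply: eq_bigr => b _.
    by rewrite mulrA chi_residue_diff residue_diffC; ring.
  have [coNk|/chi_not_coprime ->] := boolP (coprime k N); last by rewrite !mul0r.
  by rewrite sum_residue_diff ?mulr0.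
- have [coNb|/chi_not_coprime ->] := boolP (coprime b N); last by rewrite mul0r normr0 mulr_ge0.
  rewrite normrM -[leRHS]mul1r; apply: ler_pM => //; first exact: chi_norm_le1.
  exact: partial_diff_bound.
Qed.

(* By [chi_residue_diff] the summand is symmetric in [a] and [b], so that the hyperbola method
   applies; replacing [D b (X / b)] by [D b X] then costs [O(1 / Y)] for each [b <= Y]. *)
Lemma sum_diff_bound Y :
  `|\sum_(1 <= b < (Y ^ 2).+1) \sum_(1 <= a < (Y ^ 2).+1 | (a * b <= Y ^ 2)%N)
     x b * delta a b * f a * f b| <= 4 * N%:R + 12 * N%:R ^+ 2.
Proof.
have tC a b : x b * delta a b * f a * f b = x a * delta b a * f b * f a.
  by rewrite residue_diffC chi_residue_diff residue_diffC; ring.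
rewrite (hyperbola_sum _ tC).
set X := (Y ^ 2)%N.
have inner Z b : \sum_(1 <= a < Z.+1) x b * delta a b * f a * f b = x b * D b Z * f b.
  by rewrite /D mulr_sumr mulr_suml; apply: eq_bigr => a _; rewrite residue_diffC; ring.
have -> : \sum_(1 <= b < Y.+1) \sum_(1 <= a < X.+1 | (a * b <= X)%N) x b * delta a b * f a * f b =
    \sum_(1 <= b < Y.+1) x b * (D b (X %/ b) - D b X) * f b + \sum_(1 <= b < Y.+1) x b * D b X * f b.
  rewrite -big_split /=; apply: eq_big_nat => b /andP[b_gt0 _].
  rewrite -mulrDl -mulrDr subrK -inner [RHS](@big_nat_widen _ _ _ _ _ X.+1); last by rewrite ltnS leq_div.
  by apply: eq_bigl => a; rewrite ltnS leq_divRL.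
have -> : \sum_(1 <= b < Y.+1) \sum_(1 <= a < Y.+1) x b * delta a b * f a * f b =
    \sum_(1 <= b < Y.+1) x b * D b Y * f b.
  by apply: eq_bigr => b _; rewrite inner.
set S := \sum_(1 <= b < Y.+1) x b * (D b (X %/ b) - D b X) * f b.
have S_bound : `|S| <= 2 * N%:R.
  apply: le_trans (ler_norm_sum _ _ _) _.
  apply: (@le_trans _ _ (\sum_(1 <= b < Y.+1) 2 * N%:R * Y%:R^-1)).
    apply: ler_sum_nat => b /andP[b_gt0 lebY].
    have [coNb|/chi_not_coprime ->] := boolP (coprime b N); last first.
      by rewrite !mul0r normr0 !mulr_ge0 ?invr_ge0.
    rewrite !normrM (ger0_norm (invsqrt_ge0 _ _)).
    have D_le := partial_diff_cauchy coNb (leq_div X b).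
    apply: (@le_trans _ _ (1 * (2 * N%:R * f (X %/ b).+1) * f b)).
      by apply: ler_wpM2r; [exact: invsqrt_ge0 | apply: ler_pM => //; apply: chi_norm_le1].
    rewrite mul1r -mulrA -invsqrtM; apply: ler_wpM2l; first by rewrite mulr_ge0.
    (* Since [(X %/ b).+1 * b] exceeds [X = Y ^ 2], its inverse square root is at most [1 / Y]. *)
    rewrite -(@invsqrt_sqr R Y); have := @invsqrt_mono R X ((X %/ b).+1 * b)%N.
    rewrite (ltnW (ltn_ceil _ _)) // expn_gt0 (leq_trans b_gt0) //.
    by move=> /(_ isT)/andP[].
  rewrite sumr_const_nat subn1 /= -[_ *+ _]mulr_natr.
  case: (posnP Y) => [->|Y_gt0]; first by rewrite mulr0 mulr_ge0.
  by rewrite mulfVK // pnatr_eq0 -lt0n.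
(* The sum is [2 * (S + S1) - S2], bounded by [2 * (2 N + 4 N^2) + 4 N^2]. *)
have H1 := sum_chi_partial_diff X Y; have H2 := sum_chi_partial_diff Y Y.
move: S_bound H1 H2; rewrite mulr2n.
set S1 := \sum_(_ <= b < _) _; set S2 := \sum_(_ <= b < _) _.
rewrite !ler_norml => /andP[? ?] /andP[? ?] /andP[? ?]; lra.
Qed.

Lemma sum_by_product (s : nat -> R) X b : (0 < b)%N ->
  \sum_(1 <= a < X.+1 | (a * b <= X)%N) s (a * b)%N =
  \sum_(1 <= m < X.+1 | (b %| m)%N) s m.
Proof.
move=> b_gt0; transitivity (\sum_(1 <= a < (X %/ b).+1) s (a * b)%N).
  rewrite [RHS](@big_nat_widen _ _ _ _ _ X.+1); last by rewrite ltnS leq_div.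
  by apply: eq_bigl => a; rewrite ltnS leq_divRL.
elim: X => [|X IH]; first by rewrite div0n !big_geq.
rewrite [RHS]big_mkcond big_nat_recr //= -big_mkcond -IH divnS //.
case: (boolP (b %| X.+1)%N) => [bX|_]; rewrite /= ?add0n ?addr0 //.
rewrite add1n big_nat_recr //=; congr (_ + s _).
by rewrite -(divnK bX) divnS // bX add1n.
Qed.

(** Grouping by [m = a * b]: only the character depends on the factorization. *)
Lemma sum_diff_divisors X :
  \sum_(1 <= b < X.+1) \sum_(1 <= a < X.+1 | (a * b <= X)%N) x b * delta a b * f a * f b =
  \sum_(1 <= m < X.+1) ((m == eps %[mod N])%:R - (m == 1 %[mod N])%:R) * f m
     * (\sum_(b <- divisors m) chi b)%:~R.
Proof.
pose s m : R := ((m == eps %[mod N])%:R - (m == 1 %[mod N])%:R) * f m.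
transitivity (\sum_(1 <= b < X.+1) \sum_(1 <= m < X.+1 | (b %| m)%N) s m * x b).
  apply: eq_big_nat => b /andP[b_gt0 _]; rewrite -mulr_suml -sum_by_product // mulr_suml.
  by apply: eq_bigr => a _; rewrite /s invsqrtM /delta; ring.
rewrite (exchange_big_dep_nat xpredT) //=; apply: eq_big_nat => m /andP[m_gt0 ltmX].
rewrite -mulr_sumr rmorph_sum /=; congr (_ * _).
rewrite -big_filter; apply: perm_big; apply: uniq_perm.
- exact/filter_uniq/iota_uniq.
- exact: divisors_uniq.
move=> b; rewrite mem_filter mem_index_iota -dvdn_divisors //.
case: (boolP (b %| m)%N) => //= dvd_bm; rewrite (dvdn_gt0 m_gt0 dvd_bm) /=.
exact: leq_ltn_trans (dvdn_leq m_gt0 dvd_bm) ltmX.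
Qed.

Lemma exists_residue_divisor_sum :
  (forall m, (0 < m)%N -> 0 <= \sum_(b <- divisors m) chi b) ->
  (forall k, (0 < k)%N -> coprime k N -> 1 <= \sum_(b <- divisors (k ^ 2)) chi b) ->
  exists m, [/\ (0 < m)%N, m = eps %[mod N] & 0 < \sum_(b <- divisors m) chi b].
Proof.
pose g m := \sum_(b <- divisors m) chi b.
move=> g_ge0 g_sqr.
pose G m := (m == 1 %[mod N])%:R * f m * (g m)%:~R : R.
have G_ge0 m : 0 <= G m.
  case: (posnP m) => [->|m_gt0]; first by rewrite /G /invsqrt sqrtr0 invr0 mulr0 mul0r.
  by rewrite !mulr_ge0 ?invsqrt_ge0 ?ler0z ?g_ge0.
pose C : R := 4 * N%:R + 12 * N%:R ^+ 2.
have [J ltCJ] := harmonic_unbounded (N.+1%:R * C).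
(* These squares lie in the class of 1 and contribute at least [1 / (j N + 1)] each. As
   [j N + 1 <= j (N + 1)] for [j >= 1], they dominate the harmonic sum divided by [N + 1]. *)
pose K j := ((j * N).+1 ^ 2)%N; pose X := K J.
have [/existsP[/= m /and3P[m_gt0 /eqP m_eps g_gt0]]|/existsPn no_m] :=
  boolP [exists m : 'I_X.+1, [&& (0 < m)%N, m == eps %[mod N] & 0 < g m]].
  by exists m.
(* Without a positive divisor sum in the class of [eps], that class only lowers the difference, so
   the class of 1 alone is bounded by [C]. *)
have ltXC : \sum_(1 <= m < X.+1) G m <= C.
  apply: le_trans (sum_diff_bound (J * N).+1); rewrite -/X -normrN.
  apply: le_trans (ler_norm _); rewrite sum_diff_divisors -sumrN.
  apply: ler_sum_nat => m /andP[m_gt0 ltmX]; rewrite /G mulrBl mulrBl opprB lerDl oppr_ge0.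
  have := no_m (Ordinal ltmX); rewrite /= m_gt0 /=; case: eqP => /= [_|]; last by rewrite !mul0r.
  by rewrite -leNgt mul1r => g_le0; rewrite mulr_ge0_le0 ?invsqrt_ge0 // lerz0.
have K_mono j : (K j < K j.+1)%N by rewrite /K ltn_exp2r // ltnS ltn_pmul2r.
have := le_trans (sum_squares_le J G_ge0 K_mono) ltXC; rewrite leNgt => /negP[].
rewrite mulrC -ltr_pdivlMr ?ltr0n // in ltCJ; apply: lt_le_trans ltCJ _.
rewrite mulr_suml; apply: ler_sum => j _.
have coK : coprime (j.+1 * N).+1 N by rewrite -addn1 -coprime_modl modnMDl coprime_modl coprime1n.
have K1 : K j.+1 == 1 %[mod N] by rewrite /K -modnXm -addn1 modnMDl modnXm exp1n.
rewrite /G K1 mul1r invsqrt_sqr.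
apply: (@le_trans _ _ ((j.+1 * N).+1%:R^-1 * 1)).
  rewrite mulr1 -invfM -natrM lef_pV2 ?posrE ?ltr0n // ler_nat; nia.
by rewrite ler_wpM2l ?invr_ge0 // ler1z g_sqr.
Qed.

End ResidueClasses.

(** * Divisor sums of a real character *)

Section DivisorSums.
Variable chi : nat -> int.
Hypothesis chiM : forall a b, chi (a * b)%N = chi a * chi b.
Hypothesis chi1 : chi 1 = 1.
Hypothesis chi_values : forall a, [|| chi a == -1, chi a == 0 | chi a == 1].

Local Notation g := (fun m => \sum_(b <- divisors m) chi b).

(** Raising the exponent to [e.+1] adds exactly the divisors [q ^ e.+1 * d] with [d] dividing
    [m]. *)
Lemma divisor_sum_prime_power q e m : prime q -> ~~ (q %| m)%N -> (0 < m)%N ->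
  g (q ^ e * m)%N = (\sum_(0 <= i < e.+1) chi q ^+ i) * g m.
Proof.
move=> q_pr q_m m_gt0; have q_gt0 := prime_gt0 q_pr.
have chiX k : chi (q ^ k)%N = chi q ^+ k.
  by elim: k => [|k IH]; rewrite ?expn0 // expnS chiM IH exprS.
elim: e => [|e IH]; first by rewrite expn0 mul1n big_nat1 expr0 mul1r.
have M_gt0 k : (0 < q ^ k * m)%N by rewrite muln_gt0 expn_gt0 q_gt0.
have dvdE : perm_eq (divisors (q ^ e.+1 * m))
    (divisors (q ^ e * m) ++ [seq (q ^ e.+1 * d)%N | d <- divisors m]).
  apply: uniq_perm; first exact: divisors_uniq.
    have inj_mul : injective (muln (q ^ e.+1)).
      by move=> d1 d2 /eqP; rewrite eqn_pmul2l ?expn_gt0 ?q_gt0 // => /eqP.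
    rewrite cat_uniq divisors_uniq (map_inj_uniq inj_mul) divisors_uniq andbT /=.
    apply/hasPn => d /mapP[d' _ ->]; rewrite -dvdn_divisors //.
    apply: contra q_m => dvd; have := dvdn_trans (dvdn_mulr d' (dvdnn _)) dvd.
    by rewrite expnSr dvdn_pmul2l // expn_gt0 q_gt0.
  move=> d; rewrite mem_cat -!dvdn_divisors //; apply/idP/orP.
    move=> dvd_d; have d_gt0 := dvdn_gt0 (M_gt0 _) dvd_d.
    have [d0 co_d0 def_d] := pfactor_coprime q_pr d_gt0; set k := logn q d in def_d.
    have dvd_d0 : (d0 %| m)%N.
      rewrite -(@Gauss_dvdr _ (q ^ e.+1)) 1?coprime_sym ?coprimeXl //.
      by apply: dvdn_trans dvd_d; rewrite def_d dvdn_mulr.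
    have [le_ke|lt_ek] := leqP k e.
      by left; rewrite def_d mulnC dvdn_mul // dvdn_exp2l.
    right; have := dvd_d; rewrite def_d -(subnK lt_ek) expnD mulnA [X in (X %| _)%N]mulnC.
    rewrite dvdn_pmul2l ?expn_gt0 ?q_gt0 // => dvd'.
    by apply/mapP; exists (d0 * q ^ (k - e.+1))%N; [rewrite -dvdn_divisors | rewrite mulnC].
  case=> [dvd_d|/mapP[d']]; first by rewrite expnS -mulnA dvdn_mull.
  by rewrite -dvdn_divisors // => dvd_d' ->; rewrite dvdn_pmul2l // expn_gt0 q_gt0.
rewrite (perm_big _ dvdE) big_cat /= IH big_map [in RHS]big_nat_recr //= mulrDl [chi q ^+ _ * _]mulr_sumr.
by congr (_ + _); apply: eq_bigr => d _; rewrite chiM chiX.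
Qed.

Lemma sum_powers_sign (x : int) e : [|| x == -1, x == 0 | x == 1] ->
  \sum_(0 <= i < e.+1) x ^+ i =
  if x == 1 then e.+1%:R else if x == 0 then 1 else (~~ odd e)%:R.
Proof.
case/or3P=> /eqP -> /=.
- elim: e => [|e IH]; first by rewrite big_nat1.
  by rewrite big_nat_recr //= IH -signr_odd /=; case: (odd e).
- by rewrite big_nat_recl //= big1 ?addr0 ?expr0 // => i _; rewrite expr0n.
- by under eq_bigr => i _ do rewrite expr1n; rewrite sumr_const_nat subn0.
Qed.

Lemma prime_power_ind (P : nat -> Prop) :
  P 1%N ->
  (forall q e m, prime q -> (0 < e)%N -> (0 < m)%N -> ~~ (q %| m)%N -> P m -> P (q ^ e * m)%N) ->
  forall m, (0 < m)%N -> P m.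
Proof.
move=> P1 Pq m; elim/ltn_ind: m => m IH m_gt0.
have [m1|m_gt1] := leqP m 1; first by have -> : m = 1%N by lia.
have q_pr := pdiv_prime m_gt1; set q := pdiv m in q_pr.
have [m' co_m' def_m] := pfactor_coprime q_pr m_gt0.
have e_gt0 : (0 < logn q m)%N by rewrite logn_gt0 mem_primes q_pr m_gt0 pdiv_dvd.
have m'_gt0 : (0 < m')%N by move: m_gt0; rewrite {1}def_m muln_gt0 => /andP[].
rewrite def_m mulnC; apply: Pq => //; first by rewrite -prime_coprime.
apply: IH => //; rewrite [ltnRHS]def_m -[ltnLHS]muln1 ltn_pmul2l //.
by rewrite -(exp1n (logn q m)) ltn_exp2r // prime_gt1.
Qed.

Lemma divisor_sum_ge0 m : (0 < m)%N -> 0 <= g m.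
Proof.
move: m; apply: prime_power_ind => [|q e m q_pr e_gt0 m_gt0 q_m g_ge0].
  by rewrite big_seq1 chi1.
rewrite divisor_sum_prime_power // mulr_ge0 // sum_powers_sign //.
by case: ifP => // _; case: ifP.
Qed.

(** All exponents are even, so each local factor is [e.+1] or 1. *)
Lemma divisor_sum_sqr k : (0 < k)%N -> 1 <= g (k ^ 2)%N.
Proof.
move: k; apply: prime_power_ind => [|q e m q_pr e_gt0 m_gt0 q_m g_ge1].
  by rewrite big_seq1 chi1.
rewrite expnMn -expnM divisor_sum_prime_power ?expn_gt0 ?m_gt0 //; last by rewrite Euclid_dvdX // negb_and q_m.
rewrite -[1](mulr1 (1 : int)); apply: ler_pM => //; rewrite sum_powers_sign // muln2 odd_double /=.
by case: (chi q == 1); rewrite ?ler1n //; case: (chi q == 0).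
Qed.

(** A prime of odd exponent with [chi q = -1] would make the sum vanish, so [chi q = 1] there and
    [- n] is a square modulo [q]. These primes form [d], their square roots being glued by the
    Chinese remainder theorem; the rest is a square. *)
Lemma square_part_of_divisor_sum n m :
  (forall q, prime q -> chi q = 1 -> exists H, (q %| H ^ 2 + n)%N) ->
  (0 < m)%N -> (forall q, prime q -> (q %| m)%N -> chi q != 0) -> 0 < g m ->
  exists s d H, m = (s ^ 2 * d)%N /\ (d %| H ^ 2 + n)%N.
Proof.
move=> sqr_n; move: m.
apply: prime_power_ind => [|q e m q_pr e_gt0 m_gt0 q_m IH] chi_neq0.
  by exists 1%N, 1%N, 0%N; rewrite dvd1n.
rewrite divisor_sum_prime_power // sum_powers_sign //.
have chi_q : chi q != 0 by apply: chi_neq0 => //; rewrite dvdn_mulr // dvdn_exp.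
rewrite (negPf chi_q) => g_gt0.
have g_m_gt0 : 0 < g m.
  rewrite lt0r divisor_sum_ge0 // andbT; apply/eqP => g0.
  by rewrite g0 mulr0 ltxx in g_gt0.
have {IH} := IH _ g_m_gt0; case=> [p p_pr p_m|s [d [H [def_m dvd_d]]]].
  by apply: chi_neq0; rewrite // dvdn_mull.
have [e_odd|e_even] := boolP (odd e); last first.
  exists (q ^ e./2 * s)%N, d, H; split=> //.
  by rewrite def_m expnMn -expnM muln2 halfK (negPf e_even) subn0 mulnA.
move: g_gt0; rewrite e_odd /=; case: ifP => [/eqP chi_q1 _|_]; last by rewrite mul0r ltxx.
have [Hq dvd_q] := sqr_n q q_pr chi_q1.
have co_qd : coprime q d.
  rewrite prime_coprime //; apply: contra q_m => q_d.
  by rewrite def_m dvdn_mull.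
exists (q ^ e./2 * s)%N, (q * d)%N, (chinese q d Hq H); split.
  have -> : (q ^ e = (q ^ e./2) ^ 2 * q)%N.
    by rewrite -expnM muln2 -expnSr -{1}(odd_double_half e) e_odd.
  by rewrite def_m expnMn; ring.
rewrite Gauss_dvd //; apply/andP; split.
  by rewrite /dvdn -modnDml -modnXm chinese_modl // modnXm modnDml.
by rewrite /dvdn -modnDml -modnXm chinese_modr // modnXm modnDml.
Qed.

End DivisorSums.

(** * Quadratic reciprocity *)

Definition is_sign (x : int) : bool := [|| x == -1, x == 0 | x == 1].

Lemma is_signM x y : is_sign x -> is_sign y -> is_sign (x * y).
Proof. by case/or3P=> /eqP ->; case/or3P=> /eqP ->. Qed.

Lemma is_signX x k : is_sign x -> is_sign (x ^+ k).
Proof. by move=> sx; elim: k => // k IH; rewrite exprS is_signM. Qed.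

Lemma is_sign_sqr x : is_sign x -> x != 0 -> x ^+ 2 = 1.
Proof. by case/or3P=> /eqP ->. Qed.

Lemma is_sign_inj (K : fieldType) x y : (2%:R : K) != 0 -> is_sign x -> is_sign y ->
  x%:~R = y%:~R :> K -> x = y.
Proof.
move=> K2; have K1 := oner_neq0 K.
have K11 : (1 : K) != -1 by rewrite -addr_eq0 -[1 + 1]/(2%:R).
case/or3P=> /eqP ->; case/or3P=> /eqP -> //=; rewrite ?rmorphN ?rmorph1 ?rmorph0 => /eqP.
- by rewrite oppr_eq0 (negPf K1).
- by rewrite eq_sym (negPf K11).
- by rewrite eq_sym oppr_eq0 (negPf K1).
- by rewrite eq_sym (negPf K1).
- by rewrite (negPf K11).
- by rewrite (negPf K1).
Qed.

(** * The Legendre symbol and Jacobi sums *)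

Section QuadraticCharacter.
Variable p : nat.
Hypotheses (p_pr : prime p) (p_odd : odd p).

(** The Legendre symbol, defined through Euler's criterion so that multiplicativity is immediate. *)
Definition quad_char (a : 'F_p) : int :=
  if a == 0 then 0 else if a ^+ p./2 == 1 then 1 else -1.

Lemma half_gt0 : (0 < p./2)%N.
Proof. by case: p p_pr p_odd => [|[|[|]]]. Qed.

Lemma half_eq : (p = p./2.*2.+1)%N.
Proof. by rewrite -{1}(odd_double_half p) p_odd. Qed.

Lemma Fp_eq0 n : (n%:R == 0 :> 'F_p) = (p %| n)%N.
Proof. by rewrite -(dvdn_pcharf (pchar_Fp p_pr)). Qed.

Lemma Fp_two_neq0 : (2%:R : 'F_p) != 0.
Proof.
by rewrite Fp_eq0 gtnNdvd //; have := half_gt0; have := half_eq; lia.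
Qed.

Lemma Fp_expr_pred (a : 'F_p) : a != 0 -> (a ^+ p./2) ^+ 2 = 1.
Proof.
move=> a_neq0; apply: (mulfI a_neq0); rewrite mulr1 -exprM -exprS muln2 -half_eq.
by rewrite -{2}(expf_card a) card_Fp.
Qed.

Lemma quad_charE a : (quad_char a)%:~R = a ^+ p./2.
Proof.
rewrite /quad_char; case: eqVneq => [->|a_neq0]; first by rewrite expr0n; case: p./2 half_gt0.
by case: eqP => // ah; have := Fp_expr_pred a_neq0; move/eqP; rewrite sqrf_eq1 => /orP[] /eqP.
Qed.

Lemma quad_char_sign a : is_sign (quad_char a).
Proof. by rewrite /quad_char; case: eqP => // _; case: eqP. Qed.

Lemma quad_char_eq0 a : (quad_char a == 0) = (a == 0).
Proof. by rewrite /quad_char; case: (a == 0) => //; case: (_ == 1). Qed.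

Lemma quad_char_inj x y : is_sign x -> is_sign y -> x%:~R = y%:~R :> 'F_p -> x = y.
Proof. exact: is_sign_inj Fp_two_neq0. Qed.

Lemma quad_charM a b : quad_char (a * b) = quad_char a * quad_char b.
Proof.
apply: quad_char_inj; rewrite ?is_signM ?quad_char_sign //.
by rewrite rmorphM /= !quad_charE exprMn.
Qed.

Lemma quad_char1 : quad_char 1 = 1.
Proof. by rewrite /quad_char oner_eq0 expr1n eqxx. Qed.

Lemma quad_charN1 : quad_char (-1) = (-1) ^+ p./2.
Proof.
apply: quad_char_inj; rewrite ?is_signX ?quad_char_sign //.
by rewrite quad_charE rmorphXn rmorphN1.
Qed.

Lemma quad_char_sqr a : a != 0 -> quad_char (a ^+ 2) = 1.
Proof.
move=> a_neq0; rewrite expr2 quad_charM -expr2 is_sign_sqr ?quad_char_sign //.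
by rewrite quad_char_eq0.
Qed.

Lemma unit_generator : exists2 g : {unit 'F_p},
  #[g]%g = p.-1 & forall u : {unit 'F_p}, exists k, u = (g ^+ k)%g.
Proof.
have /cyclicP[g gE] := field_unit_group_cyclic [group of [set: {unit 'F_p}]].
exists g => [|u]; first by rewrite /order -gE card_finField_unit card_Fp.
by have /cycleP : u \in <[g]>%g; rewrite -?gE ?inE.
Qed.

(** If [a] is the power [k] of a generator, then [p.-1] divides [k * p./2], so [k] is even. *)
Lemma quad_char_eq1_sqr a : quad_char a = 1 -> exists y, a = y ^+ 2.
Proof.
rewrite /quad_char; case: eqVneq => // a_neq0; case: eqP => // ah _.
have [g ord_g gen_g] := unit_generator.
have a_unit : a \is a GRing.unit by rewrite unitfE.
have [k def_a] := gen_g (FinRing.Unit a_unit).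
have /eqP : (g ^+ (k * p./2) = 1)%g.
  by apply: val_inj; rewrite expgM -def_a FinRing.val_unitX /=.
rewrite -order_dvdn ord_g [X in X.-1]half_eq /= -mul2n dvdn_pmul2r ?half_gt0 // => k_even.
exists (val g ^+ k./2); rewrite -exprM muln2 halfK -FinRing.val_unitX.
by rewrite dvdn2 in k_even; rewrite (negPf k_even) subn0 -def_a.
Qed.

Lemma quad_char_nonresidue : exists2 a, a != 0 & quad_char a = -1.
Proof.
have [g ord_g _] := unit_generator; exists (val g); first by rewrite -unitfE (valP g).
have g_neq0 : val g != 0 by rewrite -unitfE (valP g).
rewrite /quad_char (negPf g_neq0); case: eqP => // gh.
have /eqP : (g ^+ p./2 = 1)%g by apply: val_inj; rewrite FinRing.val_unitX.
rewrite -order_dvdn ord_g => /(dvdn_leq half_gt0); have := half_gt0; have := half_eq; lia.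
Qed.

Lemma sum_quad_char : \sum_(a : 'F_p) quad_char a = 0.
Proof.
have [b b_neq0 chi_b] := quad_char_nonresidue.
have : \sum_(a : 'F_p) quad_char a = - \sum_(a : 'F_p) quad_char a; last by lia.
rewrite {1}(reindex_onto ( *%R b) ( *%R b^-1)) /=; last by move=> a _; rewrite mulVKf.
rewrite -sumrN; apply: eq_big => [a|a _]; first by rewrite mulKf ?eqxx.
by rewrite quad_charM chi_b mulN1r.
Qed.

(** The coefficient of [z ^ s] in the square of the Gauss sum. *)
Definition jacobi_sum s := \sum_(a : 'F_p) quad_char a * quad_char (s - a).

Lemma jacobi_sum0 : jacobi_sum 0 = quad_char (-1) * p.-1%:R.
Proof.
rewrite /jacobi_sum (bigD1 0) //= {1}/quad_char eqxx mul0r add0r.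
have -> : quad_char (-1) * p.-1%:R = \sum_(a : 'F_p | a != 0) quad_char (-1).
  have -> : p.-1 = #|[pred a : 'F_p | a != 0]| by rewrite cardC1 card_Fp.
  by rewrite sumr_const mulr_natr.
apply: eq_bigr => a a_neq0.
rewrite sub0r -[- a]mulN1r quad_charM.
by rewrite mulrCA -quad_charM -expr2 quad_char_sqr // mulr1.
Qed.

(** Scaling by [s] shows that all nonzero [s] give the same value. The total over all [s] is the
    square of [sum_quad_char], hence zero, and [jacobi_sum0] determines that value. *)
Lemma jacobi_sum_neq0 s : s != 0 -> jacobi_sum s = - quad_char (-1).
Proof.
have jacobi_sum1 t : t != 0 -> jacobi_sum t = jacobi_sum 1.
  move=> t_neq0; rewrite /jacobi_sum.
  rewrite (reindex_onto ( *%R t) ( *%R t^-1)) /=; last by move=> a _; rewrite mulVKf.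
  apply: eq_big => [a|a _]; first by rewrite mulKf ?eqxx.
  have -> : t - t * a = t * (1 - a) by ring.
  by rewrite !quad_charM mulrACA -[_ t * _ t]quad_charM -[t * t]expr2 quad_char_sqr // mul1r.
move=> s_neq0; rewrite jacobi_sum1 //.
have : \sum_(t : 'F_p) jacobi_sum t = 0.
  rewrite exchange_big big1 //= => a _; rewrite -mulr_sumr.
  rewrite (reindex_onto (fun b => b + a) (fun b => b - a)) /=; last by move=> b _; rewrite subrK.
  rewrite (eq_big xpredT quad_char) ?sum_quad_char ?mulr0 // => b; rewrite addrK ?eqxx //.
rewrite (bigD1 0) //= jacobi_sum0 (eq_bigr (fun=> jacobi_sum 1)); last by move=> t /jacobi_sum1.
have -> : \sum_(t : 'F_p | t != 0) jacobi_sum 1 = jacobi_sum 1 * p.-1%:R.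
  have -> : p.-1 = #|[pred a : 'F_p | a != 0]| by rewrite cardC1 card_Fp.
  by rewrite sumr_const mulr_natr.
rewrite -mulrDl => /eqP; rewrite mulf_eq0 => /orP[|]; last first.
  by rewrite pnatr_eq0 => /eqP; have := half_gt0; have := half_eq; lia.
by rewrite addrC addr_eq0 => /eqP.
Qed.

End QuadraticCharacter.

(** * Gauss sums and the reciprocity law *)

Section GaussSum.
Variables (p : nat) (K : fieldType) (z : K).
Hypotheses (p_pr : prime p) (p_odd : odd p) (z_prim : p.-primitive_root z).

Definition add_char (a : 'F_p) : K := z ^+ val a.

Lemma add_char_nat n : add_char n%:R = z ^+ n.
Proof. by rewrite /add_char /= val_Fp_nat // (prim_expr_mod z_prim). Qed.

Lemma add_charD a b : add_char (a + b) = add_char a * add_char b.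
Proof. by rewrite -[a]natr_Zp -[b]natr_Zp -natrD !add_char_nat exprD. Qed.

Lemma add_charM n a : add_char (n%:R * a) = add_char a ^+ n.
Proof. by rewrite -[a]natr_Zp -natrM !add_char_nat mulnC exprM. Qed.

Lemma sum_add_char : \sum_a add_char a = 0.
Proof.
have z1 : add_char 1 != 1.
  rewrite -[1]/(1%:R) add_char_nat -(prim_order_dvd z_prim).
  by rewrite dvdn1; apply: contraTneq p_pr => ->.
have : add_char 1 * \sum_a add_char a = \sum_a add_char a.
  rewrite mulr_sumr [RHS](reindex_onto (+%R 1) (+%R (- 1))) /=; last by move=> a _; rewrite addNKr.
  by apply: eq_big => [a|a _]; rewrite ?addKr ?eqxx ?add_charD.
move/eqP; rewrite -subr_eq0 -{2}[\sum_a _]mul1r -mulrBl mulf_eq0 subr_eq0 (negPf z1).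
by move/eqP.
Qed.

Definition gauss_sum : K := \sum_a (quad_char a)%:~R * add_char a.

Lemma gauss_sum_sqr : gauss_sum ^+ 2 = (quad_char (-1 : 'F_p))%:~R * p%:R.
Proof.
have add_char0 : add_char 0 = 1 by rewrite -[0]/(0%:R) add_char_nat.
rewrite expr2 {1}/gauss_sum mulr_suml.
transitivity (\sum_(s : 'F_p) (jacobi_sum s)%:~R * add_char s).
  transitivity (\sum_(a : 'F_p) \sum_(s : 'F_p)
      (quad_char a * quad_char (s - a))%:~R * add_char s); last first.
    by rewrite exchange_big; apply: eq_bigr => s _; rewrite rmorph_sum mulr_suml.
  apply: eq_bigr => a _; rewrite mulr_sumr.
  rewrite (reindex_onto (fun s => s - a) (fun s => s + a)) /=; last by move=> b _; rewrite addrK.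
  apply: eq_big => [s|s _]; first by rewrite subrK eqxx.
  have -> : add_char s = add_char (s - a) * add_char a by rewrite -add_charD subrK.
  by rewrite rmorphM /=; ring.
rewrite (bigD1 0) //= jacobi_sum0 // add_char0 mulr1.
have sum_ne0 : \sum_(s : 'F_p | s != 0) add_char s = -1.
  by move/eqP: sum_add_char; rewrite (bigD1 0) //= add_char0 addrC addr_eq0 => /eqP.
rewrite (eq_bigr (fun s => (- quad_char (-1 : 'F_p))%:~R * add_char s)); last first.
  by move=> s /jacobi_sum_neq0 ->.
rewrite -mulr_sumr sum_ne0 rmorphN rmorphM /= mulrNN mulr1.
have -> : p%:R = p.-1%:R + 1 :> K by rewrite natr1 prednK ?prime_gt0.
by rewrite mulrDr mulr1 rmorph_nat.
Qed.

(** In characteristic [q] the power [q] is additive and fixes the integer values, so it only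
    replaces [a] by [q * a] in the additive character. *)
Lemma gauss_sum_Frobenius q : q \in [pchar K] -> ~~ (p %| q)%N ->
  gauss_sum ^+ q = (quad_char (q%:R : 'F_p))%:~R * gauss_sum.
Proof.
move=> charK p_q; have q_neq0 : (q%:R : 'F_p) != 0 by rewrite Fp_eq0.
rewrite -(pFrobenius_autE charK) /gauss_sum rmorph_sum mulr_sumr.
rewrite [RHS](reindex_onto ( *%R q%:R) ( *%R q%:R^-1)) /=; last by move=> a _; rewrite mulVKf.
apply: eq_big => [a|a _]; first by rewrite mulKf ?eqxx.
rewrite rmorphM /= rmorph_int pFrobenius_autE add_charM quad_charM // mulrA -intrM mulrA.
by rewrite -[_ q%:R * _]quad_charM // -expr2 quad_char_sqr // mul1r.
Qed.

End GaussSum.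

(** In the field with [q ^ p.-1] elements, Fermat's theorem makes [p] divide the order of the unit
    group, and Cauchy's theorem applies. *)
Lemma primitive_root_in_char p q : prime p -> prime q -> p != q ->
  exists (K : finFieldType) (z : K), q \in [pchar K] /\ p.-primitive_root z.
Proof.
move=> p_pr q_pr neq_pq.
have p1_gt0 : (0 < p.-1)%N by rewrite -subn1 subn_gt0 prime_gt1.
have [K charK cardK] := pPrimePowerField q_pr p1_gt0; exists K.
have p_dvd : (p %| #|[set: {unit K}]|)%N.
  rewrite card_finField_unit cardK -subn1 -eqn_mod_dvd ?expn_gt0 ?prime_gt0 //.
  have co_pq : coprime q p by rewrite prime_coprime // dvdn_prime2 // eq_sym.
  by rewrite -(totient_prime p_pr) Euler_exp_totient.
have [u _ ord_u] := Cauchy (G := [group of [set: {unit K}]]) p_pr p_dvd.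
exists (val u); split=> //.
have up : val u ^+ p = 1 by rewrite -FinRing.val_unitX -ord_u expg_order.
have [m u_prim] := prim_order_exists (prime_gt0 p_pr) up.
case/primeP: (p_pr) => _ dvdp /dvdp /orP[] /eqP m_eq; rewrite m_eq in u_prim => //.
have /eqP u1 := prim_expr_order u_prim.
have : u = 1%g by apply: val_inj; apply/eqP; rewrite -[val u]expr1.
by move=> u_1; have := prime_gt1 p_pr; rewrite -ord_u u_1 order1.
Qed.

(** The power [tau ^+ q] of the Gauss sum is computed by Frobenius and as
    [tau * (tau ^+ 2) ^+ q./2]; cancelling [tau] compares signs in [K]. *)
Lemma quadratic_reciprocity p q : prime p -> odd p -> prime q -> odd q -> p != q ->
  quad_char (q%:R : 'F_p) = quad_char (p%:R : 'F_q) * (-1) ^+ (p./2 * q./2).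
Proof.
move=> p_pr p_odd q_pr q_odd neq_pq.
have [K [z [charK z_prim]]] := primitive_root_in_char p_pr q_pr neq_pq.
have nat_eq0 n : (n%:R == 0 :> 'F_q) = (n%:R == 0 :> K).
  by rewrite Fp_eq0 // (dvdn_pcharf charK).
have K2 : (2%:R : K) != 0 by rewrite -nat_eq0 Fp_two_neq0.
(* Euler's criterion holds in ['F_q]; it transfers to [K] because the same natural numbers vanish in
   both fields. *)
have pK : (quad_char (p%:R : 'F_q))%:~R = p%:R ^+ q./2 :> K.
  have := quad_charE q_pr q_odd p%:R; rewrite -!natrX.
  have := quad_char_sign (p%:R : 'F_q); case/or3P=> /eqP -> /=.
  - move/eqP; rewrite rmorphN1 eq_sym -addr_eq0 natr1 nat_eq0 -natr1 addr_eq0.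
    by move/eqP ->; rewrite rmorphN1.
  - by move/eqP; rewrite eq_sym nat_eq0 => /eqP ->.
  - rewrite -(prednK (_ : 0 < p ^ q./2)%N) ?expn_gt0 ?prime_gt0 // -!natr1 => /eqP.
    by rewrite rmorph1 eq_sym -subr_eq0 addrK nat_eq0 => /eqP ->; rewrite add0r.
have dvd_pq : ~~ (p %| q)%N by rewrite dvdn_prime2.
have p_neq0 : (p%:R : K) != 0 by rewrite -nat_eq0 Fp_eq0 // dvdn_prime2 // eq_sym.
set c := quad_char (-1 : 'F_p).
have c_neq0 : (c%:~R : K) != 0.
  by rewrite /c quad_charN1 // rmorphXn rmorphN1 expf_neq0 // oppr_eq0 oner_eq0.
have tau2 := gauss_sum_sqr p_pr p_odd z_prim; set tau := gauss_sum p z in tau2.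
have tau_neq0 : tau != 0 by rewrite -sqrf_eq0 tau2 mulf_neq0.
apply: (is_sign_inj K2); rewrite ?is_signM ?is_signX ?quad_char_sign //.
apply: (mulIf tau_neq0); rewrite -(gauss_sum_Frobenius p_pr p_odd z_prim charK dvd_pq) -/tau.
rewrite [X in tau ^+ X](half_eq q_odd) exprSr -muln2 mulnC exprM tau2 exprMn -pK.
by rewrite rmorphM /= /c quad_charN1 // !rmorphXn /= exprM [_%:~R * _]mulrC.
Qed.

(** * Sums of three squares *)

(** The nontrivial character modulo 4. *)
Definition char4 (m : nat) : int := if odd m then (-1) ^+ m./2 else 0.

Lemma char4_mod (m N : nat) : (4 %| N)%N -> char4 (m %% N)%N = char4 m.
Proof.
move=> dvd4; suff H k : char4 k = char4 (k %% 4)%N by rewrite H modn_dvdm // -H.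
rewrite {1}(divn_eq k 4) /char4.
have -> : (k %/ 4 * 4 = (k %/ 4).*2.*2)%N by rewrite -!muln2 -mulnA.
by rewrite oddD odd_double /= halfD odd_double /= add0n doubleK exprD -signr_odd odd_double mul1r.
Qed.

Lemma char4M a b : char4 (a * b)%N = char4 a * char4 b.
Proof.
rewrite -(@char4_mod (a * b)%N 4) // -modnMm -(@char4_mod a 4) // -(@char4_mod b 4) //.
have : (a %% 4 < 4)%N by rewrite ltn_mod.
have : (b %% 4 < 4)%N by rewrite ltn_mod.
by case: (a %% 4)%N => [|[|[|[|]]]] //; case: (b %% 4)%N => [|[|[|[|]]]].
Qed.

Lemma char4_sign a : is_sign (char4 a).
Proof. by rewrite /char4; case: odd => //; rewrite is_signX. Qed.

Lemma char4_eq0 a : (char4 a == 0) = ~~ odd a.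
Proof. by rewrite /char4; case: odd => //=; rewrite signr_eq0. Qed.

(** * The character attached to [- n] *)

Section Character.
Variable n : nat.
Hypothesis n_mod4 : n = 1 %[mod 4].

(** The symbol [(- n / m)] in its reciprocal form, [char4] times the Jacobi symbol [(m / n)], for
    which periodicity modulo [4 * n] is evident. *)
Definition three_squares_char (m : nat) : int :=
  char4 m * \prod_(f <- prime_decomp n) quad_char (m%:R : 'F_f.1) ^+ f.2.
Local Notation chi := three_squares_char.

Let n_odd : odd n.
Proof. by rewrite -(odd_mod n (erefl : odd 4 = false)) n_mod4. Qed.

Let n_gt0 : (0 < n)%N.
Proof. by case: n n_odd. Qed.

Lemma char4_n : char4 n = 1.
Proof. by rewrite -(@char4_mod n 4) // n_mod4. Qed.

Lemma prime_decomp_factor f : f \in prime_decomp n ->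
  [/\ prime f.1, odd f.1, (f.1 %| n)%N & (0 < f.2)%N].
Proof.
case: f => l e /mem_prime_decomp[l_pr e_gt0 dvd_n] /=.
have dvd_l : (l %| n)%N by apply: dvdn_trans dvd_n; rewrite dvdn_exp.
by split=> //; apply: dvdn_odd n_odd.
Qed.

Lemma char4_n_prod : char4 n = \prod_(f <- prime_decomp n) char4 f.1 ^+ f.2.
Proof.
rewrite {1}(prod_prime_decomp n_gt0); elim: (prime_decomp n) => [|f l IH].
  by rewrite !big_nil.
rewrite !big_cons char4M // IH; congr (_ * _).
by elim: f.2 => [|k IHk]; rewrite ?expr0 // expnS exprS char4M IHk.
Qed.

Lemma three_squares_char_mod m : chi (m %% (4 * n))%N = chi m.
Proof.
rewrite /chi char4_mod ?dvdn_mulr //; congr (_ * _); apply: eq_big_seq => f.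
case/prime_decomp_factor=> f_pr _ f_n _; congr (quad_char _ ^+ _).
by rewrite -[LHS]Fp_nat_mod // -[RHS]Fp_nat_mod // modn_dvdm // dvdn_mull.
Qed.

Lemma three_squares_charM a b : chi (a * b)%N = chi a * chi b.
Proof.
rewrite /chi char4M mulrACA -big_split /=; congr (_ * _); apply: eq_big_seq => f.
by case/prime_decomp_factor=> f_pr f_odd _ _; rewrite natrM quad_charM // exprMn.
Qed.

Lemma three_squares_char_sign a : is_sign (chi a).
Proof.
rewrite is_signM ?char4_sign // big_seq; elim/big_ind: _ => //; first exact: is_signM.
by move=> f _; rewrite is_signX // quad_char_sign.
Qed.

Lemma three_squares_char_neq0 a : (chi a != 0) = coprime a (4 * n).
Proof.
rewrite mulf_eq0 negb_or char4_eq0 negbK coprimeMr -[4%N]/(2 ^ 2)%N coprime_pexpr // coprimen2.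
congr (_ && _); rewrite prodf_seq_neq0; apply/allP/idP => [all_neq0|co_an f f_n]; last first.
  have [f_pr f_odd dvd_n f2_gt0] := prime_decomp_factor f_n.
  rewrite expf_neq0 // quad_char_eq0 // Fp_eq0 // -prime_coprime // coprime_sym.
  exact: coprime_dvdr dvd_n co_an.
apply/contraT => nco_an; have gcd_gt1 : (1 < gcdn a n)%N.
  by rewrite ltn_neqAle eq_sym nco_an gcdn_gt0 n_gt0 orbT.
set l := pdiv (gcdn a n); have l_pr : prime l by apply: pdiv_prime.
have l_a : (l %| a)%N by apply: dvdn_trans (pdiv_dvd _) (dvdn_gcdl _ _).
have : l \in primes n by rewrite mem_primes l_pr n_gt0 (dvdn_trans (pdiv_dvd _) (dvdn_gcdr _ _)).
case/mapP=> f f_n def_l; have := all_neq0 f f_n.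
have [f_pr f_odd dvd_n f2_gt0] := prime_decomp_factor f_n.
by rewrite /= expf_eq0 f2_gt0 quad_char_eq0 // Fp_eq0 // -def_l l_a.
Qed.

Lemma three_squares_char_eq1 q : prime q -> chi q = 1 -> exists H, (q %| H ^ 2 + n)%N.
Proof.
move=> q_pr chi_q; have : chi q != 0 by rewrite chi_q.
rewrite three_squares_char_neq0 coprimeMr -[4%N]/(2 ^ 2)%N coprime_pexpr // coprimen2 => /andP[q_odd co_qn].
have chi_n : quad_char (n%:R : 'F_q) =
    \prod_(f <- prime_decomp n) quad_char (f.1%:R : 'F_q) ^+ f.2.
  rewrite {1}(prod_prime_decomp n_gt0); elim: (prime_decomp n) => [|f l IH].
    by rewrite !big_nil quad_char1.
  rewrite !big_cons natrM quad_charM // IH natrX; congr (_ * _).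
  by elim: f.2 => [|k IHk]; rewrite ?expr0 ?quad_char1 // !exprS quad_charM // IHk.
have reciprocity : \prod_(f <- prime_decomp n) quad_char (f.1%:R : 'F_q) ^+ f.2 =
    \prod_(f <- prime_decomp n) quad_char (q%:R : 'F_f.1) ^+ f.2.
  (* The reciprocity signs multiply to [char4 n ^+ q./2], which is 1 as [n] is 1 modulo 4. *)
  transitivity (\prod_(f <- prime_decomp n) quad_char (f.1%:R : 'F_q) ^+ f.2 * char4 n ^+ q./2).
    by rewrite char4_n expr1n mulr1.
  rewrite char4_n_prod -prodrXl -big_split /=.
  apply: eq_big_seq => f /prime_decomp_factor[f_pr f_odd f_n _].
  have neq : f.1 != q.
    by apply: contraTneq f_n => ->; rewrite -prime_coprime.
  rewrite (@quadratic_reciprocity f.1 q) // /char4 f_odd exprMn; congr (_ * _).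
  by rewrite -!exprM mulnA mulnAC.
have : quad_char (- n%:R : 'F_q) = 1.
  rewrite -mulN1r quad_charM // quad_charN1 // chi_n reciprocity.
  by move: chi_q; rewrite /chi /char4 q_odd.
case/(quad_char_eq1_sqr q_pr q_odd) => y /eqP.
rewrite eq_sym -addr_eq0 -[y]natr_Zp -natrX -natrD Fp_eq0 // => dvd; by exists y.
Qed.

Lemma exists_square_mod : exists s d H,
  (n %| s ^ 2 * d + 1)%N /\ (d %| H ^ 2 + n)%N.
Proof.
have n4 : coprime 4 n by rewrite -[4%N]/(2 ^ 2)%N coprime_pexpl // coprime2n n_odd.
(* Being [-1] modulo [n], this class makes [s ^ 2 * d + 1] divisible by [n]. Being 1 modulo 4, it
   has [chi eps] equal to the Jacobi symbol of [-1], which is [char4 n = 1]. *)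
pose eps := chinese 4 n 1 (n.-1).
have eps4 : eps = 1 %[mod 4] by apply: chinese_modl.
have epsn : eps = n.-1 %[mod n] by apply: chinese_modr.
have N_gt0 : (0 < 4 * n)%N by rewrite muln_gt0 n_gt0.
have chi_sqr a : chi a ^+ 2 = (coprime a (4 * n))%:R.
  rewrite -three_squares_char_neq0; have := three_squares_char_sign a; case: eqVneq => [->//|chi0].
  by move/is_sign_sqr/(_ chi0).
have chi_eps : chi eps = 1.
  rewrite /chi -(@char4_mod eps 4) // eps4 mul1r -[RHS]char4_n char4_n_prod.
  apply: eq_big_seq => f /prime_decomp_factor[f_pr f_odd f_n _]; congr (_ ^+ _).
  have -> : eps%:R = -1 :> 'F_f.1.
    apply/eqP; rewrite -subr_eq0 opprK natr1 Fp_eq0 // -addn1 /dvdn -modnDml.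
    rewrite -(modn_dvdm eps f_n) epsn modn_dvdm // modnDml addn1 (prednK n_gt0); exact: f_n.
  by rewrite quad_charN1 // /char4 f_odd.
have chi_values a : [|| chi a == -1, chi a == 0 | chi a == 1] := three_squares_char_sign a.
have chi_1 : chi 1 = 1 by have := three_squares_charM 1 eps; rewrite mul1n chi_eps mulr1 => <-.
have [m [m_gt0 m_eps g_gt0]] := exists_residue_divisor_sum realalg N_gt0
  three_squares_charM three_squares_char_mod chi_sqr chi_eps
  (divisor_sum_ge0 three_squares_charM chi_1 chi_values)
  (fun k k_gt0 _ => divisor_sum_sqr three_squares_charM chi_1 chi_values k_gt0).
have co_m : coprime m (4 * n).
  by rewrite -three_squares_char_neq0 -three_squares_char_mod m_eps three_squares_char_mod chi_eps.
have chi_m q : prime q -> (q %| m)%N -> chi q != 0.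
  by move=> q_pr q_m; rewrite three_squares_char_neq0; apply: coprime_dvdl q_m co_m.
have [s [d [H [def_m dvd_d]]]] :=
  square_part_of_divisor_sum three_squares_charM chi_1 chi_values three_squares_char_eq1
    m_gt0 chi_m g_gt0.
exists s, d, H; rewrite -def_m; split=> //.
rewrite /dvdn -modnDml -(modn_dvdm m (dvdn_mull 4 (dvdnn n))) m_eps modn_dvdm ?dvdn_mull //.
by rewrite epsn modnDml addn1 prednK ?n_gt0 // modnn.
Qed.

End Character.

Local Open Scope Z_scope.

Lemma three_squares (n : Z) : 0 < n -> n mod 4 = 1 ->
  exists x y z : Z, n = x ^ 2 + y ^ 2 + z ^ 2.
Proof.
move=> n_gt0 n_mod4; have [m nE] : exists m, Z.of_nat m = n by exists (Z.to_nat n); lia.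
have m_gt0 : (0 < m)%N by lia.
have m_mod4 : (m = 1 %[mod 4])%N.
  have := Z.div_mod n 4 (ltac:(done)); rewrite n_mod4 => nq.
  have -> : m = (Z.to_nat (n / 4) * 4 + 1)%N by lia.
  by rewrite modnMDl.
have [s [d [H [n_dvd d_dvd]]]] := exists_square_mod m_mod4.
have co_sm : coprime s m.
  have dvd_sd : (gcdn m s %| s ^ 2 * d)%N by rewrite dvdn_mulr // expnS dvdn_mulr // dvdn_gcdr.
  rewrite coprime_sym /coprime -dvdn1 -(dvdn_addr _ dvd_sd).
  exact: dvdn_trans (dvdn_gcdl _ _) n_dvd.
have [t st] := modn_inverse m_gt0 co_sm.
have [C HC] := dvdnP d_dvd; have [j Hj] := dvdnP n_dvd.
have d_gt0 : (0 < d)%N by rewrite lt0n; apply: contraTneq d_dvd => ->; rewrite dvd0n; lia.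
have [k Hk] : exists k : Z, Z.of_nat s * Z.of_nat t = 1 + n * k.
  (* The term [1 %/ m] accounts for [m = 1], where 1 reduces to 0. *)
  exists (Z.of_nat (s * t %/ m) - Z.of_nat (1 %/ m)).
  have := divn_eq (s * t) m; have := divn_eq 1 m; rewrite st.
  move: (s * t %/ m)%N (1 %/ m)%N (1 %% m)%N => q1 q0 r H0 H1.
  by rewrite -nE; clear -H0 H1; lia.
apply: (three_squares_of_congruences n (Z.of_nat d) (Z.of_nat s) (Z.of_nat H) (Z.of_nat C)
  (Z.of_nat t) k (Z.of_nat j)) => //; first by lia.
- have {}HC : (C * d = H * H + m)%N by rewrite -HC mulnn.
  by rewrite Z.pow_2_r; clear -HC nE; lia.
- have {}Hj : (s * s * d + 1 = j * m)%N by rewrite -Hj mulnn.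
  by rewrite Z.pow_2_r; clear -Hj nE; lia.
Qed.

From Stdlib Require Import Znumtheory.

Theorem theorem3p9 :
  forall p : Z, prime p ->
    p <> 2 -> p <> 3 -> p <> 7 -> p <> 17 -> p <> 23 ->
    exists a b c d : Z,
      a mod 5 = d mod 5 /\ b mod 5 = c mod 5 /\
      5 * p = a ^ 2 + 29 * b ^ 2 + c ^ 2 + 29 * d ^ 2.
Proof.
intros p p_prime neq2 neq3 neq7 neq17 neq23.
destruct (Z_le_gt_dec p 421) as [le_p | gt_p].
- apply represented_small; assumption.
- apply (represented_large three_squares); [assumption | apply Z.gt_lt; assumption].
Qed.
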